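(* Let $m, N$ be positive integers and let $A = (a_{ji})$ be an $m \times N$ random matrix whose entries $a_{ji}$, $j \in [m]$, $i \in [N]$, are independent, symmetric, unit-variance random variables, all distributed as a random variable $X$. \begin{enumerate} \item[(a)] Suppose $X$ fulfills the weak moment assumption of order $\max\{4,\log(m)\}$ with constants $\kappa_1$ and $\gamma \geq 1/2$. Then there exist an absolute constant $c_0$ and constants $\widetilde{C}$ and $D$ such that, whenever $m$ is large enough that $4 e^{4\gamma} c_0^2 \kappa_1^2 \log(m) \leq m$ and $N \geq \max\{\widetilde{C} m, \log^{2\gamma-1}(m)\}$, with probability at least $1 - 2\exp(-2m)$ the matrix $\frac{1}{\sqrt{m}} A$ fulfills the $\ell_1$-quotient property with constant $D$ relative to the clipped $\ell_2$-norm $\|\cdot\|^{(\sqrt{\log(eN/m)})} = \max\{\|\cdot\|_2, \sqrt{\log(eN/m)}\,\|\cdot\|_\infty\}$ on $\mathbb{R}^m$. \item[(b)] Suppose $X$ is super-Gaussian with parameter $0 < \sigma \leq 1$. Then there exist constants $\widetilde{C}$ and $D$ (depending on $\sigma$) such that whenever $N \geq \widetilde{C} m$, with probability at least $1 - 2\exp(-2m)$ the matrix $\frac{1}{\sqrt{m}} A$ fulfills the $\ell_1$-quotient property with constant $D$ relative to the $\ell_2$-norm on $\mathbb{R}^m$. \end{enumerate}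
   Context: All logarithms are natural; $[N] = \{1,\dots,N\}$. For a random variable $X$, $\|X\|_{L_p} = (\mathbb{E}|X|^p)^{1/p}$. Let $X$ be a random variable with $\mathbb{E}[X]=0$ and $\mathbb{E}[X^2]=1$. $X$ is super-Gaussian with parameter $\sigma>0$ if $\mathbb{P}(|\sigma g| > t) \leq \mathbb{P}(|X| > t)$ for all $t>0$, where $g$ is a standard normal random variable. $X$ fulfills the weak moment assumption of order $k$ with constants $\kappa_1$ and $\gamma \geq 1/2$ if $\|X\|_{L_p} \leq \kappa_1 p^{\gamma}$ for all $4 \leq p \leq k$. A matrix $M \in \mathbb{R}^{m\times N}$ has the $\ell_1$-quotient property with constant $d$ relative to a norm $\|\cdot\|$ on $\mathbb{R}^m$ if for every $w \in \mathbb{R}^m$ there exists $u \in \mathbb{R}^N$ with $Mu = w$ and $\|u\|_1 \leq d\, s_*^{1/2} \|w\|$, where $s_* = m/\log(eN/m)$. *)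

(* Defs.v *)
From HB Require Import structures.
From mathcomp Require Import all_boot all_order all_algebra.
From mathcomp Require Import all_classical all_reals all_analysis.
Set Implicit Arguments. Unset Strict Implicit. Unset Printing Implicit Defensive.
Import Order.TTheory GRing.Theory Num.Theory.
Import numFieldNormedType.Exports.
Local Open Scope classical_set_scope.
Local Open Scope ring_scope.

Section defs.
Context {R : realType}.

Definition mutually_independent {d} {T : measurableType d} (P : probability T R)
  (I : finType) (Y : I -> T -> R) : Prop :=
  forall (J : {set I}) (B : I -> set R), (forall i, measurable (B i)) ->
    P (\bigcap_(i in [set i | i \in J]) (Y i @^-1` B i)) =
    (\prod_(i in J) P (Y i @^-1` B i))%E.

Definition symmetric_rv {d} {T : measurableType d} (P : probability T R)
  (Y : T -> R) : Prop :=
  forall B : set R, measurable B ->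
    P (Y @^-1` B) = P ((fun w => - Y w) @^-1` B).

Definition same_distribution {d d'} {T : measurableType d} {T' : measurableType d'}
  (P : probability T R) (Y : T -> R) (P' : probability T' R) (X : T' -> R) : Prop :=
  forall B : set R, measurable B -> P (Y @^-1` B) = P' (X @^-1` B).

Definition centered_unit_variance {d} {T : measurableType d} (P : probability T R)
  (X : {RV P >-> R}) : Prop :=
  ('E_P[X] = 0)%E /\ ('E_P[(fun w => (X w ^+ 2)%R)] = 1)%E.

Definition random_matrix_model {d d'} {T : measurableType d}
  {T' : measurableType d'} (m N : nat) (P : probability T R)
  (a : 'I_m -> 'I_N -> {RV P >-> R}) (P' : probability T' R) (X : {RV P' >-> R})
  : Prop :=
  [/\ mutually_independent P (fun ji : 'I_m * 'I_N => (a ji.1 ji.2 : T -> R)),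
      (forall j i, symmetric_rv P (a j i)),
      (forall j i, same_distribution P (a j i) P' X) &
      centered_unit_variance X].

Definition weak_moment {d} {T : measurableType d} (P : probability T R)
  (X : T -> R) (k kappa1 gamma : R) : Prop :=
  forall p : R, 4 <= p <= k ->
    (Lnorm P p%:E (EFin \o X) <= (kappa1 * p `^ gamma)%:E)%E.

Definition super_gaussian {d} {T : measurableType d} (P : probability T R)
  (X : T -> R) (sigma : R) : Prop :=
  forall t : R, 0 < t ->
    (normal_prob 0 1 [set x : R | (t < `|sigma * x|)%R] <= P [set w | (t < `|X w|)%R])%E.

(** "E holds with probability at least p": E contains a measurable event of
    probability >= p (so no measurability of E itself is presupposed). *)
Definition with_prob_at_least {d} {T : measurableType d} (P : probability T R)
  (E : set T) (p : R) : Prop :=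
  exists F : set T, [/\ measurable F, F `<=` E & (p%:E <= P F)%E].

Definition l1norm n (u : 'cV[R]_n) : R := \sum_(i < n) `|u i ord0|.
Definition l2norm n (w : 'cV[R]_n) : R := Num.sqrt (\sum_(i < n) (w i ord0) ^+ 2).
Definition linfnorm n (w : 'cV[R]_n) : R := \big[Num.max/0]_(i < n) `|w i ord0|.

Definition clipped_norm (alpha : R) n (w : 'cV[R]_n) : R :=
  Num.max (l2norm w) (alpha * linfnorm w).

Definition s_star (m N : nat) : R := m%:R / ln (expR 1 * N%:R / m%:R).

Definition l1_quotient_property (m N : nat) (M : 'M[R]_(m, N)) (D : R)
  (nrm : 'cV[R]_m -> R) : Prop :=
  forall w : 'cV[R]_m, exists u : 'cV[R]_N,
    M *m u = w /\ l1norm u <= D * Num.sqrt (s_star m N) * nrm w.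

Definition scaled_matrix {d} {T : measurableType d} (m N : nat)
  (a : 'I_m -> 'I_N -> T -> R) (w : T) : 'M[R]_(m, N) :=
  (Num.sqrt m%:R)^-1 *: \matrix_(j < m, i < N) a j i w.

End defs.

(* Main.v *)
Require Import Defs.
From HB Require Import structures.
From mathcomp Require Import all_boot all_order all_algebra.
From mathcomp Require Import ring lra zify.
From mathcomp Require Import all_classical all_reals all_analysis.
From mathcomp Require Import measurable_realfun.
Import Order.TTheory GRing.Theory Num.Theory.
Import numFieldNormedType.Exports.
Local Open Scope classical_set_scope.
Local Open Scope ring_scope.
Set Implicit Arguments.
Unset Strict Implicit.
Unset Printing Implicit Defensive.

(* Let [h] be the support function of the norm ball whose radius is the
   clipping level. By duality, the quotient property says that the columns [x_i]
   satisfy [h y <= D * max_i |<x_i, y>|] for all [y]. For a fixed [y], tilting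
   the coordinates of a column [x] by independent densities correlated with a
   near maximizer [z] of [<y, z>] shows that [<x, y> >= kappa * h y] with
   probability [p] of order [(N/m)^(-1/2)]; only [P(|X| > 1/2) > 0] is needed
   when the entries of [z] are bounded by 1, and a Gaussian lower tail
   otherwise. By Chernoff, for fixed [y], at least [p N / 4] columns satisfy
   this, except with probability [exp(- p N / 4)]; this beats a grid of mesh
   [p / sqrt m], which has [exp(O(m log(1/p)))] points near the sphere. An
   arbitrary [y] is rounded randomly and coordinatewise to the grid: the error
   [<x, y - xi>] then has second moment at most [mesh^2 |x|^2], so some grid
   point [xi] is good for all but few columns, and no operator norm bound is
   involved. Quantizing the entries makes all these probabilities finite
   sums. *)

Section finite_mean.
Context {R : realFieldType} {V : finType}.
Implicit Types (q f g h : V -> R) (E : pred V).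

Definition is_pmf q : Prop := (forall a, 0 <= q a) /\ \sum_a q a = 1.

Definition mean q h : R := \sum_a q a * h a.

Definition prob q E : R := mean q (fun a => (E a)%:R).

Lemma eq_mean q f g : f =1 g -> mean q f = mean q g.
Proof. by move=> fg; apply: eq_bigr => a _; rewrite fg. Qed.

Lemma meanD q f g : mean q (fun a => f a + g a) = mean q f + mean q g.
Proof. by rewrite /mean -big_split; apply: eq_bigr => a _; rewrite mulrDr. Qed.

Lemma meanZ q k f : mean q (fun a => k * f a) = k * mean q f.
Proof. by rewrite /mean big_distrr; apply: eq_bigr => a _; rewrite mulrCA. Qed.

Lemma meanB q f g : mean q (fun a => f a - g a) = mean q f - mean q g.
Proof. by rewrite /mean -sumrB; apply: eq_bigr => a _; rewrite mulrBr. Qed.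

Lemma mean_sum q (J : finType) (h : J -> V -> R) :
  mean q (fun a => \sum_j h j a) = \sum_j mean q (h j).
Proof.
by rewrite /mean exchange_big; apply: eq_bigr => a _; rewrite big_distrr.
Qed.

Lemma mean_reweight q f h :
  mean (fun a => q a * f a) h = mean q (fun a => f a * h a).
Proof. by apply: eq_bigr => a _; rewrite mulrA. Qed.

Section nonnegative_weights.
Variable q : V -> R.
Hypothesis q_ge0 : forall a, 0 <= q a.

Lemma ler_mean f g : (forall a, f a <= g a) -> mean q f <= mean q g.
Proof. by move=> fg; apply: ler_sum => a _; rewrite ler_wpM2l. Qed.

Lemma mean_ge0 f : (forall a, 0 <= f a) -> 0 <= mean q f.
Proof. by move=> f0; apply: sumr_ge0 => a _; rewrite mulr_ge0. Qed.

Lemma prob_ge0 E : 0 <= prob q E.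
Proof. by apply: mean_ge0 => a; rewrite ler0n. Qed.

Lemma ler_prob E1 E2 : (forall a, E1 a -> E2 a) -> prob q E1 <= prob q E2.
Proof.
by move=> E12; apply: ler_mean => a; rewrite ler_nat;
  case: (E1 a) (E12 a) => // ->.
Qed.

Lemma prob_or E1 E2 : prob q (fun a => E1 a || E2 a) <= prob q E1 + prob q E2.
Proof.
rewrite /prob -meanD; apply: ler_mean => a /=.
by case: (E1 a); case: (E2 a); rewrite /= ?addr0 ?add0r ?lerDl ?ler01.
Qed.

Lemma prob_has (K : Type) (E : K -> pred V) (s : seq K) :
  prob q (fun a => has (E^~ a) s) <= \sum_(k <- s) prob q (E k).
Proof.
elim: s => [|k s IH]; last first.
  by rewrite big_cons (le_trans (prob_or _ _))// lerD2l.
by rewrite big_nil /prob /mean big1// => a _; rewrite mulr0.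
Qed.

Lemma prob_markov h (t : R) : 0 < t -> (forall a, 0 <= h a) ->
  prob q (fun a => t <= h a) <= mean q h / t.
Proof.
move=> t0 h0; rewrite mulrC -meanZ; apply: ler_mean => a /=.
case: (leP t) => [th|_]; first by rewrite ler_pdivlMl ?mulr1.
by rewrite mulr_ge0// invr_ge0 ltW.
Qed.

Lemma mean_CauchySchwarz f g :
  mean q (fun a => f a * g a) ^+ 2 <=
  mean q (fun a => f a ^+ 2) * mean q (fun a => g a ^+ 2).
Proof.
pose A := mean q (fun a => f a ^+ 2); pose C := mean q (fun a => g a ^+ 2).
pose B := mean q (fun a => f a * g a).
have lagrange :
    mean q (fun a => mean q (fun b => (f a * g b - f b * g a) ^+ 2)) =
    2 * (A * C - B ^+ 2).
  have inner a : mean q (fun b => (f a * g b - f b * g a) ^+ 2) =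
      C * f a ^+ 2 - 2 * B * (f a * g a) + A * g a ^+ 2.
    rewrite ![_ * f a ^+ 2]mulrC -[_ * (f a * g a)]mulrAC ![_ * g a ^+ 2]mulrC.
    rewrite -!meanZ -meanB -meanD; apply: eq_mean => b; ring.
  by rewrite (eq_mean _ inner) meanD meanB !meanZ -/A -/B -/C; ring.
rewrite -subr_ge0 -(pmulr_rge0 _ (ltr0Sn R 1)) -lagrange.
by do 2!apply: mean_ge0 => ?; exact: sqr_ge0.
Qed.

Lemma prob_reweight_le f E :
  prob (fun a => q a * f a) E ^+ 2 <= mean q (fun a => f a ^+ 2) * prob q E.
Proof.
rewrite /prob mean_reweight (le_trans (mean_CauchySchwarz _ _))// le_eqVlt.
apply/orP; left; apply/eqP; congr (_ * _); apply: eq_mean => a.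
by case: (E a); rewrite ?expr1n ?expr0n.
Qed.

End nonnegative_weights.

Section pmf.
Variable q : V -> R.
Hypothesis q_pmf : is_pmf q.

Let q_ge0 : forall a, 0 <= q a. Proof. exact: q_pmf.1. Qed.

Lemma mean_cst k : mean q (fun=> k) = k.
Proof. by rewrite /mean -big_distrl/= q_pmf.2 mul1r. Qed.

Lemma exists_le_mean h : exists a, h a <= mean q h.
Proof.
apply/existsP; apply: contraT => /existsPn h_gt.
have gap a : 0 <= q a * (h a - mean q h).
  by rewrite mulr_ge0// subr_ge0 ltW// ltNge.
have : \sum_a q a * (h a - mean q h) == 0.
  by rewrite -/(mean q _) meanB mean_cst subrr.
rewrite psumr_eq0// => /allP gap0; have /eqP := q_pmf.2.
rewrite big1 ?(eq_sym 0) ?oner_eq0// => a _; apply/eqP.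
have := gap0 a (mem_index_enum a); rewrite /= mulf_eq0 => /orP[//|].
by rewrite subr_eq0 => /eqP ha; have := h_gt a; rewrite ha lexx.
Qed.

Lemma paley_zygmund (S : V -> R) (K : R) : 0 < mean q S ->
  mean q (fun a => S a ^+ 2) <= K * mean q S ^+ 2 ->
  (4 * K)^-1 <= prob q (fun a => mean q S / 2 <= S a).
Proof.
set M := mean q S => M0 SK; set p := prob q _.
have upper_part : M / 2 <= prob (fun a => q a * S a) (fun a => M / 2 <= S a).
  suff : M <= M / 2 + prob (fun a => q a * S a) (fun a => M / 2 <= S a) by lra.
  rewrite /prob mean_reweight -[X in _ <= X + _](mean_cst (M / 2)) -meanD.
  by apply: ler_mean => // a; case: (leP (M / 2)) => [MS|/ltW];
    rewrite ?mulr1 ?mulr0; lra.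
have := prob_reweight_le q_ge0 S (fun a => M / 2 <= S a); rewrite -/p => tail.
have p_ge0 : 0 <= p by exact: prob_ge0.
have : M ^+ 2 * 4^-1 <= M ^+ 2 * (K * p).
  rewrite mulrA (mulrC (M ^+ 2) K) (le_trans _ (ler_wpM2r p_ge0 SK))//.
  apply: le_trans tail; rewrite (_ : _ * _ = (M / 2) ^+ 2); last by field.
  by rewrite lerXn2r// nnegrE; lra.
rewrite ler_pM2l ?exprn_gt0// => Kp.
have K0 : 0 < K.
  by rewrite ltNge; apply/negP => /mulr_le0_ge0/(_ p_ge0); lra.
by rewrite invfM ler_pdivrMr// mulrC.
Qed.

End pmf.
End finite_mean.

Section product_weights.
Context {R : realFieldType} {I V : finType}.
Implicit Types (F : I -> V -> R) (v : {ffun I -> V}).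

Definition prodw F v : R := \prod_i F i (v i).

Lemma mean_prodw_prod F (g : I -> V -> R) :
  mean (prodw F) (fun v => \prod_i g i (v i)) = \prod_i mean (F i) (g i).
Proof.
by rewrite /mean bigA_distr_bigA; apply: eq_bigr => v _; rewrite -big_split.
Qed.

Lemma prodwM F (f : I -> V -> R) v :
  prodw (fun i a => F i a * f i a) v = prodw F v * prodw f v.
Proof. exact: big_split. Qed.

Variable F : I -> V -> R.
Hypothesis F_pmf : forall i, is_pmf (F i).

Lemma prodw_ge0 v : 0 <= prodw F v.
Proof. by apply: prodr_ge0 => i _; exact: (F_pmf i).1. Qed.

Lemma prodw_pmf : is_pmf (prodw F).
Proof.
split=> [v|]; first exact: prodw_ge0.
rewrite /prodw -(bigA_distr_bigA F) big1// => i _; exact: (F_pmf i).2.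
Qed.

Lemma mean_prodw_coord i (g : V -> R) :
  mean (prodw F) (fun v => g (v i)) = mean (F i) g.
Proof.
pose G k a := if k == i then g a else 1.
rewrite (@eq_mean _ _ _ _ (fun v => \prod_k G k (v k))) => [|v].
  rewrite mean_prodw_prod (bigD1 i)//= /G eqxx big1 ?mulr1// => k /negPf ->.
  exact: mean_cst.
by rewrite (bigD1 i)//= /G eqxx big1 ?mulr1// => k /negPf ->.
Qed.

Lemma mean_prodw_coord2 i j (g h : V -> R) : i != j ->
  mean (prodw F) (fun v => g (v i) * h (v j)) = mean (F i) g * mean (F j) h.
Proof.
rewrite eq_sym => /negPf ji.
pose G k a := if k == i then g a else if k == j then h a else 1.
rewrite (@eq_mean _ _ _ _ (fun v => \prod_k G k (v k))) => [|v].
  rewrite mean_prodw_prod (bigD1 i)//= (bigD1 j) ?ji//= /G !eqxx ji.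
  by rewrite big1 ?mulr1// => k /andP[/negPf -> /negPf ->]; exact: mean_cst.
rewrite (bigD1 i)//= (bigD1 j) ?ji//= /G !eqxx ji.
by rewrite big1 ?mulr1// => k /andP[/negPf -> /negPf ->].
Qed.

Lemma mean_prodw_sqr_sum (g : I -> V -> R) :
  mean (prodw F) (fun v => (\sum_i g i (v i)) ^+ 2) <=
  \sum_i mean (F i) (fun a => g i a ^+ 2) + (\sum_i mean (F i) (g i)) ^+ 2.
Proof.
have sqr_sum (x : I -> R) : (\sum_i x i) ^+ 2 = \sum_i \sum_j x i * x j.
  by rewrite expr2 big_distrl; apply: eq_bigr => i _; rewrite big_distrr.
rewrite (eq_mean _ (fun v => sqr_sum (fun i => g i (v i)))) mean_sum.
rewrite sqr_sum -big_split/=; apply: ler_sum => i _.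
rewrite mean_sum (bigD1 i)//= [X in _ <= _ + X](bigD1 i)//= addrA.
apply: lerD; last by apply: ler_sum => j ji; rewrite mean_prodw_coord2 1?eq_sym.
by rewrite (mean_prodw_coord i (fun a => g i a * g i a)) lerDl -expr2 sqr_ge0.
Qed.

End product_weights.

Section exponential_tails.
Context {R : realType} {I V : finType}.
Variable F : I -> V -> R.
Hypothesis F_pmf : forall i, is_pmf (F i).

Lemma prob_prodw_sum_ge (g : I -> V -> R) (t : R) :
  prob (prodw F) (fun v => t <= \sum_i g i (v i)) <=
  expR (- t) * \prod_i mean (F i) (fun a => expR (g i a)).
Proof.
rewrite -mean_prodw_prod -meanZ.
apply: ler_mean => [|v]; first exact: prodw_ge0.
rewrite -expR_sum -expRD; case: (leP t) => [gt|_] /=; last exact: expR_ge0.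
by rewrite -[leLHS]expR0 ler_expR; lra.
Qed.

Lemma mean_expR_indicator (q : V -> R) (E : pred V) (s c : R) : is_pmf q ->
  expR s <= 1 + c ->
  mean q (fun a => expR (s * (E a)%:R)) <= expR (c * prob q E).
Proof.
move=> q_pmf sc; apply: le_trans (expR_ge1Dx _).
rewrite -[X in X + _](mean_cst q_pmf) -meanZ -meanD; apply: ler_mean => [|a].
  exact: q_pmf.1.
by case: (E a); rewrite /= ?mulr1 ?mulr0 ?expR0 ?addr0.
Qed.

Definition occurrences (Q : I -> pred V) (v : {ffun I -> V}) : R :=
  \sum_i (Q i (v i))%:R.

Lemma occurrences_exponential_tail (Q : I -> pred V) (s c t : R) :
  expR s <= 1 + c ->
  prob (prodw F) (fun v => t <= s * occurrences Q v) <=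
  expR (c * \sum_i prob (F i) (Q i) - t).
Proof.
move=> sc; have := prob_prodw_sum_ge (fun i a => s * (Q i a)%:R) t.
under [X in X <= _ -> _]eq_mean do rewrite -big_distrr/=.
move/le_trans; apply.
rewrite addrC expRD ler_pM2l ?expR_gt0// big_distrr expR_sum.
apply: ler_prod => i _; rewrite (mean_expR_indicator _ (F_pmf i) sc) andbT.
by apply: (mean_ge0 (F_pmf i).1) => a; exact: expR_ge0.
Qed.

Lemma occurrences_lower_tail (Q : I -> pred V) (mu k : R) :
  mu <= \sum_i prob (F i) (Q i) ->
  prob (prodw F) (fun v => occurrences Q v <= k) <= expR (k - mu / 2).
Proof.
move=> muQ; have expN1 : expR (- 1) <= 1 + - 2^-1 :> R.
  have -> : 1 + - 2^-1 = 2^-1 :> R by field.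
  rewrite expRN lef_pV2 ?posrE ?expR_gt0//.
  by have := @expR_ge1Dx R 1; lra.
have := occurrences_exponential_tail Q (- k) expN1.
under [X in X <= _ -> _]eq_mean do rewrite mulN1r lerN2.
by move/le_trans; apply; rewrite ler_expR; lra.
Qed.

Lemma occurrences_upper_tail (Q : I -> pred V) (mu k : R) :
  \sum_i prob (F i) (Q i) <= mu ->
  prob (prodw F) (fun v => k <= occurrences Q v) <= expR (mu - k / 2).
Proof.
move=> Qmu; have exp_half : expR 2^-1 <= 1 + 1 :> R.
  rewrite -[1 + 1]/2 -[leLHS]invrK -expRN -[leRHS]invrK.
  rewrite lef_pV2 ?posrE ?invr_gt0 ?expR_gt0//.
  by have := @expR_ge1Dx R (- 2^-1); lra.
have := occurrences_exponential_tail Q (2^-1 * k) exp_half.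
under [X in X <= _ -> _]eq_mean do rewrite ler_pM2l ?invr_gt0//.
by move/le_trans; apply; rewrite ler_expR; lra.
Qed.

End exponential_tails.

Section tilting.
Context {R : realType} {V : finType}.
Implicit Types (q x f : V -> R) (C c B z : R).

Definition tiltable q x C c B z : Prop :=
  exists f : V -> R,
    [/\ forall a, 0 <= f a, mean q f = 1,
        mean q (fun a => f a ^+ 2) <= expR (C * z ^+ 2),
        mean q (fun a => f a * x a) = c * z &
        mean q (fun a => f a * x a ^+ 2) <= B].

(* Under the density [\prod_i f i (v i)] the sum has mean [M] and variance at
   most [B * \sum_i y i ^+ 2], so Paley-Zygmund applies to it there;
   Cauchy-Schwarz returns to the original weights at the price of the second
   moment of the density. *)
Lemma tilted_lower_tail (I : finType) q x C c B K (y z : I -> R) :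
  is_pmf q -> 0 <= B -> (forall i, tiltable q x C c B (z i)) ->
  let M := c * \sum_i y i * z i in
  0 < M -> \sum_i y i ^+ 2 <= K * M ^+ 2 ->
  (4 * (1 + B * K)) ^- 2 * expR (- (C * \sum_i z i ^+ 2)) <=
  prob (prodw (fun=> q))
    (fun v : {ffun I -> V} => M / 2 <= \sum_i y i * x (v i)).
Proof.
move=> q_pmf B0 /choice[f /all_and5[f0 f1 f2 fx fx2]] M M0 yM.
pose G i a := q a * f i a.
pose S (v : {ffun I -> V}) := \sum_i y i * x (v i); pose T := 1 + B * K.
have G_pmf i : is_pmf (G i).
  by split=> [a|]; [rewrite mulr_ge0 ?q_pmf.1|exact: f1].
have meanGyx i : mean (G i) (fun a => y i * x a) = c * (y i * z i).
  by rewrite meanZ mean_reweight fx; ring.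
have meanS : mean (prodw G) S = M.
  rewrite mean_sum /M big_distrr; apply: eq_bigr => i _ /=.
  by rewrite (mean_prodw_coord G_pmf i (fun a => y i * x a)).
have meanS2 : mean (prodw G) (fun v => S v ^+ 2) <= T * M ^+ 2.
  apply: (le_trans (mean_prodw_sqr_sum G_pmf (fun i a => y i * x a))).
  under [X in _ + X ^+ 2]eq_bigr do rewrite meanGyx.
  rewrite -big_distrr/= -/M [leRHS]mulrDl mul1r addrC lerD2l -mulrA.
  apply: le_trans (ler_wpM2l B0 yM).
  rewrite big_distrr; apply: ler_sum => i _ /=.
  under eq_mean do rewrite exprMn.
  by rewrite meanZ mean_reweight mulrC ler_wpM2r ?sqr_ge0.
have T0 : 0 <= T.
  rewrite -(pmulr_lge0 T (exprn_gt0 2 M0)) (le_trans _ meanS2)//.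
  by apply: mean_ge0 => [|v]; [exact: prodw_ge0|exact: sqr_ge0].
have tiltedPZ : (4 * T)^-1 <= prob (prodw G) (fun v => M / 2 <= S v).
  rewrite -meanS in M0 meanS2 *.
  exact: (paley_zygmund (prodw_pmf G_pmf) M0 meanS2).
have density2 : mean (prodw (fun=> q)) (fun v => prodw f v ^+ 2) <=
    expR (C * \sum_i z i ^+ 2).
  under eq_mean do rewrite /prodw -prodrXl.
  rewrite (mean_prodw_prod (fun=> q) (fun i a => f i a ^+ 2)).
  rewrite big_distrr/= expR_sum.
  apply: ler_prod => i _; rewrite f2 andbT.
  by apply: mean_ge0 => [|a]; [exact: q_pmf.1|exact: sqr_ge0].
rewrite expRN ler_pdivrMr ?expR_gt0// [leRHS]mulrC -exprVn.
have q_pmfs (i : I) : is_pmf q by [].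
apply: le_trans (ler_wpM2r (prob_ge0 (prodw_ge0 q_pmfs) _) density2).
apply: le_trans (prob_reweight_le (prodw_ge0 q_pmfs) (prodw f) _).
have prodGE : prodw G = fun v => prodw (fun=> q) v * prodw f v.
  by apply/funext => v; exact: prodwM.
rewrite -prodGE lerXn2r ?nnegrE ?invr_ge0 ?mulr_ge0//.
by apply: prob_ge0; exact: prodw_ge0.
Qed.

(* Mixing the density [f] with the constant density lowers the tilted mean from
   [mean q (f * x)] to the prescribed value [c * z]. *)
Lemma tiltable_of_density q x C c B z f : is_pmf q ->
  mean q x = 0 -> mean q (fun a => x a ^+ 2) <= B -> 0 <= C -> 0 <= c * z ->
  (forall a, 0 <= f a) -> mean q f = 1 ->
  mean q (fun a => f a ^+ 2) <= expR (C * z ^+ 2) ->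
  c * z <= mean q (fun a => f a * x a) ->
  mean q (fun a => f a * x a ^+ 2) <= B ->
  tiltable q x C c B z.
Proof.
move=> q_pmf x0 x2 C0 cz0 f0 f1 f2.
set mu := mean q (fun a => f a * x a) => czmu fx2.
pose th := c * z / mu.
have thmu : th * mu = c * z.
  have [mu0|mu0] := eqVneq mu 0; last by rewrite divfK.
  by rewrite mu0 mulr0; apply/eqP; rewrite eq_le cz0 -mu0.
have th0 : 0 <= th by rewrite divr_ge0// (le_trans cz0).
have th1 : th <= 1.
  have [mu0|mu0] := eqVneq mu 0; first by rewrite /th mu0 invr0 mulr0.
  by rewrite ler_pdivrMr ?mul1r// lt_neqAle eq_sym mu0 (le_trans cz0).
exists (fun a => (1 - th) + th * f a); split.
- by move=> a; rewrite addr_ge0 ?subr_ge0// mulr_ge0.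
- by rewrite meanD meanZ mean_cst// f1; ring.
- apply: (@le_trans _ _ (mean q (fun a => (1 - th) + th * f a ^+ 2))).
    apply: (ler_mean q_pmf.1) => a; rewrite -subr_ge0.
    rewrite (_ : _ - _ = th * (1 - th) * (1 - f a) ^+ 2); last by ring.
    by rewrite mulr_ge0 ?sqr_ge0// mulr_ge0// subr_ge0.
  rewrite meanD meanZ mean_cst//.
  have : 1 <= expR (C * z ^+ 2) by rewrite -expR0 ler_expR mulr_ge0// sqr_ge0.
  have : th * mean q (fun a => f a ^+ 2) <= th * expR (C * z ^+ 2).
    by rewrite ler_wpM2l.
  by nra.
- under eq_mean do rewrite mulrDl -mulrA.
  by rewrite meanD !meanZ x0 -/mu thmu; ring.
- under eq_mean do rewrite mulrDl -mulrA.
  rewrite meanD !meanZ; move: x2 fx2 th0 th1; nra.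
Qed.

End tilting.

Section tilts_of_symmetric_weights.
Context {R : realType} {V : finType} (q x : V -> R) (rv : V -> V).
Hypotheses (q_pmf : is_pmf q) (x_sqr : mean q (fun a => x a ^+ 2) <= 1).
Hypotheses (rvK : involutive rv) (q_rv : forall a, q (rv a) = q a).
Hypothesis (x_rv : forall a, x (rv a) = - x a).

Lemma mean_rv (g : V -> R) : mean q (g \o rv) = mean q g.
Proof.
rewrite [RHS]/mean (reindex_inj (inv_inj rvK)).
by apply: eq_bigr => a _; rewrite q_rv.
Qed.

Lemma mean_odd (g : V -> R) : (forall a, g (rv a) = - g a) -> mean q g = 0.
Proof.
move=> g_odd; have := mean_rv g; rewrite (eq_mean _ g_odd).
by under eq_mean do rewrite -mulN1r; rewrite meanZ; lra.
Qed.

Lemma tiltableN (C c B z : R) :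
  tiltable q x C c B z -> tiltable q x C c B (- z).
Proof.
move=> [f [f0 f1 f2 fx fx2]]; exists (f \o rv); split=> //.
- by move=> a; exact: f0.
- by rewrite mean_rv.
- by rewrite sqrrN (mean_rv (fun a => f a ^+ 2)).
- have := mean_rv (fun a => f a * x a); rewrite fx mulrN => <-.
  rewrite -mulN1r -meanZ; apply: eq_mean => a /=; rewrite x_rv; ring.
- have := mean_rv (fun a => f a * x a ^+ 2) => fx2E.
  by apply: le_trans fx2; rewrite -fx2E;
    under [leRHS]eq_mean do rewrite /= x_rv sqrrN.
Qed.

Lemma tiltable_abs (C c B z : R) :
  tiltable q x C c B `|z| -> tiltable q x C c B z.
Proof. by case: (ger0P z) => // _ /tiltableN; rewrite opprK. Qed.

Lemma tiltable_small (C c B z : R) : 1 <= C -> 2 <= B -> 0 <= c ->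
  c <= mean q (fun a => `|x a|) -> `|z| <= 1 -> tiltable q x C c B z.
Proof.
move=> C1 B2 c0 cx z1; apply: tiltable_abs.
move: {z}`|z| (normr_ge0 z) z1 => z z0 z1.
have x0 : mean q x = 0 by exact: mean_odd.
have sg0 : mean q (fun a => Num.sg (x a)) = 0.
  by apply: mean_odd => a; rewrite x_rv sgrN.
have sg1 a : - 1 <= Num.sg (x a) <= 1 by case: sgrP => _; lra.
have sg2 a : Num.sg (x a) ^+ 2 <= 1 by have := sg1 a; nra.
apply: (tiltable_of_density (f := fun a => 1 + z * Num.sg (x a))) => //.
- by move: x_sqr; lra.
- exact: le_trans C1.
- exact: mulr_ge0.
- by move=> a; have := sg1 a; nra.
- by rewrite meanD meanZ mean_cst// sg0 mulr0 addr0.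
- apply: (@le_trans _ _ (1 + z ^+ 2)); last first.
    by apply: (le_trans (expR_ge1Dx _)); rewrite ler_expR ler_peMl ?sqr_ge0.
  apply: (@le_trans _ _ (mean q (fun a => 1 + z ^+ 2 + 2 * z * Num.sg (x a)))).
    apply: (ler_mean q_pmf.1) => a; have := sg2 a; have := sqr_ge0 z; nra.
  by rewrite meanD meanZ mean_cst// sg0 mulr0 addr0.
- rewrite (@eq_mean _ _ _ _ (fun a => x a + z * `|x a|)) => [|a].
    by rewrite meanD meanZ x0 add0r mulrC ler_wpM2l.
  by rewrite mulrDl mul1r -mulrA -normrEsg.
- apply: (@le_trans _ _ (mean q (fun a => 2 * x a ^+ 2)));
    last by rewrite meanZ; move: x_sqr; lra.
  apply: (ler_mean q_pmf.1) => a; rewrite ler_wpM2r ?sqr_ge0//.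
  by have := sg1 a; nra.
Qed.

Lemma prob_norm_ge_half (t : R) : 0 < t ->
  prob q (fun a => t <= `|x a|) = 2 * prob q (fun a => t <= x a).
Proof.
move=> t0; rewrite mulr_natl mulr2n.
rewrite -[X in _ = X + _](mean_rv (fun a => (t <= x a)%R%:R)).
rewrite /prob -meanD; apply: eq_mean => a /=; rewrite x_rv ler_normr.
by case: (leP t (x a)) => ta; case: (leP t (- x a)) => tb //=; lra.
Qed.

(* For [z > 0] the tilt is conditioning on [z <= x]. *)
Lemma tiltable_large (C c B z : R) : 0 <= C -> 0 < c <= 1 -> z != 0 ->
  2 * expR (- (C * z ^+ 2)) <= prob q (fun a => `|z| <= `|x a|) ->
  expR (C * z ^+ 2) <= B -> tiltable q x C c B z.
Proof.
move=> C0 /andP[c0 c1].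
rewrite -normr_gt0 -(real_normK (num_real z)) => z0 tail eV.
apply: tiltable_abs; move: {z}`|z| z0 tail eV => z z0.
rewrite prob_norm_ge_half// ler_pM2l//; set P := prob q _ => tail eV.
have P0 : 0 < P by apply: lt_le_trans tail; exact: expR_gt0.
have PV : P^-1 <= expR (C * z ^+ 2).
  by rewrite -[leRHS]invrK -expRN lef_pV2 ?posrE ?expR_gt0.
have PV0 : 0 <= P^-1 by rewrite invr_ge0 ltW.
pose I a : R := (z <= x a)%R%:R.
have I01 a : 0 <= I a <= 1 by rewrite ler0n lern1 leq_b1.
have I2 a : I a ^+ 2 = I a.
  by rewrite /I; case: (_ <= _); rewrite ?expr0n ?expr1n.
apply: (tiltable_of_density (f := fun a => P^-1 * I a)) => //.
- exact: mean_odd.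
- apply: (le_trans x_sqr); apply: le_trans eV.
  by rewrite -expR0 ler_expR mulr_ge0// sqr_ge0.
- by rewrite mulr_ge0// ltW.
- by move=> a; rewrite mulr_ge0//; case/andP: (I01 a).
- by rewrite meanZ -/(prob q _) mulVf// gt_eqF.
- under eq_mean do rewrite exprMn I2.
  by rewrite meanZ -/(prob q _) expr2 -mulrA mulVf ?mulr1// gt_eqF.
- apply: (@le_trans _ _ z); first by rewrite ler_piMl// ltW.
  under eq_mean do rewrite -mulrA.
  rewrite meanZ mulrC ler_pdivlMr// -meanZ; apply: (ler_mean q_pmf.1) => a.
  by rewrite /I; case: (leP z) => [zx|_]; rewrite ?mulr1 ?mul1r ?mulr0 ?mul0r.
- apply: le_trans eV; apply: le_trans PV.
  under eq_mean do rewrite -mulrA.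
  rewrite meanZ ler_piMr// (le_trans _ x_sqr)//; apply: (ler_mean q_pmf.1) => a.
  by rewrite ler_piMl ?sqr_ge0//; case/andP: (I01 a).
Qed.

End tilts_of_symmetric_weights.

Section euclidean.
Context {R : realType} {m : nat}.
Implicit Types u v w y : 'cV[R]_m.

Definition dot u v : R := \sum_j u j ord0 * v j ord0.

Lemma dotC u v : dot u v = dot v u.
Proof. by apply: eq_bigr => j _; rewrite mulrC. Qed.

Lemma dotDl u v w : dot (u + v) w = dot u w + dot v w.
Proof.
by rewrite /dot -big_split; apply: eq_bigr => j _; rewrite mxE mulrDl.
Qed.

Lemma dotZl (k : R) u v : dot (k *: u) v = k * dot u v.
Proof.
by rewrite /dot big_distrr/=; apply: eq_bigr => j _; rewrite mxE mulrA.
Qed.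

Lemma dotZr (k : R) u v : dot u (k *: v) = k * dot u v.
Proof. by rewrite dotC dotZl dotC. Qed.

Lemma dotBl u v w : dot (u - v) w = dot u w - dot v w.
Proof. by rewrite -scaleN1r dotDl dotZl mulN1r. Qed.

Lemma dotBr u v w : dot u (v - w) = dot u v - dot u w.
Proof. by rewrite dotC dotBl dotC (dotC w). Qed.

Lemma dot0l u : dot 0 u = 0.
Proof. by rewrite -(scale0r 0) dotZl mul0r. Qed.

Lemma dot_ge0 u : 0 <= dot u u.
Proof. by apply: sumr_ge0 => j _; rewrite -expr2 sqr_ge0. Qed.

Lemma l2norm_ge0 u : 0 <= l2norm u. Proof. exact: sqrtr_ge0. Qed.

Lemma l2norm_sqr u : l2norm u ^+ 2 = dot u u.
Proof.
rewrite sqr_sqrtr; first by apply: eq_bigr => j _; rewrite expr2.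
by apply: sumr_ge0 => j _; exact: sqr_ge0.
Qed.

Lemma l2norm_eq0 u : l2norm u = 0 -> u = 0.
Proof.
move=> u0; have /eqP := l2norm_sqr u; rewrite u0 expr0n eq_sym.
rewrite psumr_eq0 => [/allP uj|j _]; last by rewrite -expr2 sqr_ge0.
apply/colP => j; rewrite mxE; have := uj j (mem_index_enum _).
by rewrite /= mulf_eq0 orbb => /eqP.
Qed.

Lemma l2norm0 : l2norm (0 : 'cV[R]_m) = 0.
Proof. by apply/eqP; rewrite -(sqrf_eq0 (l2norm _)) l2norm_sqr dot0l. Qed.

Lemma l2norm_gt0 u : u != 0 -> 0 < l2norm u.
Proof.
by move=> u0; rewrite lt_neqAle l2norm_ge0 andbT eq_sym; apply: contra_neq u0;
  exact: l2norm_eq0.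
Qed.

Lemma l2norm_le u (r : R) : 0 <= r -> dot u u <= r ^+ 2 -> l2norm u <= r.
Proof. by move=> r0; rewrite -l2norm_sqr ler_pXn2r ?nnegrE ?l2norm_ge0. Qed.

Lemma l2normZ (k : R) u : l2norm (k *: u) = `|k| * l2norm u.
Proof.
apply/eqP; rewrite -(@eqrXn2 _ 2)// ?l2norm_ge0 ?mulr_ge0 ?l2norm_ge0//.
by rewrite exprMn !l2norm_sqr dotZl dotZr real_normK ?num_real// expr2 mulrA.
Qed.

Lemma norm_dot_le u v : `|dot u v| <= l2norm u * l2norm v.
Proof.
rewrite -(@ler_pXn2r _ 2)// ?nnegrE ?mulr_ge0 ?l2norm_ge0//.
rewrite real_normK ?num_real//.
have weight1 (g : 'I_m -> R) : mean (fun=> 1) g = \sum_j g j.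
  by apply: eq_bigr => j _; rewrite mul1r.
have := @mean_CauchySchwarz R 'I_m (fun=> 1) (fun=> ler01) (u^~ ord0)
  (v^~ ord0).
rewrite !weight1 => /le_trans; apply; rewrite exprMn !l2norm_sqr.
rewrite le_eqVlt; apply/orP; left; apply/eqP.
by congr (_ * _); apply: eq_bigr => j _; rewrite expr2.
Qed.

Lemma norm_coord_le_l2norm u j : `|u j ord0| <= l2norm u.
Proof.
rewrite -(@ler_pXn2r _ 2)// ?nnegrE ?l2norm_ge0// real_normK ?num_real//.
rewrite l2norm_sqr /dot (bigD1 j)//= -expr2 lerDl.
by apply: sumr_ge0 => k _; rewrite -expr2 sqr_ge0.
Qed.

Lemma l2norm_le_coord u (b : R) : 0 <= b -> (forall j, `|u j ord0| <= b) ->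
  l2norm u <= b * Num.sqrt m%:R.
Proof.
move=> b0 ub; apply: l2norm_le; first by rewrite mulr_ge0 ?sqrtr_ge0.
rewrite exprMn sqr_sqrtr ?ler0n// mulr_natr -[m in _ *+ m]card_ord -sumr_const.
apply: ler_sum => j _; rewrite -expr2 -[leLHS]real_normK ?num_real//.
by rewrite lerXn2r ?nnegrE.
Qed.

Lemma l1norm_le_l2norm u : l1norm u <= Num.sqrt m%:R * l2norm u.
Proof.
pose ones := const_mx 1 : 'cV[R]_m; pose absu := map_mx Num.norm u.
have -> : l1norm u = dot ones absu by apply: eq_bigr => j _; rewrite !mxE mul1r.
have abs2 : l2norm absu = l2norm u.
  by congr Num.sqrt; apply: eq_bigr => j _; rewrite mxE real_normK ?num_real.
rewrite (le_trans (ler_norm _))// (le_trans (norm_dot_le _ _))// abs2.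
rewrite ler_wpM2r ?l2norm_ge0// -[leRHS]mul1r; apply: l2norm_le_coord => // j.
by rewrite mxE normr1.
Qed.

Lemma homogeneous_of_le (f : 'cV[R]_m -> R) :
  (forall k u, 0 < k -> f (k *: u) <= k * f u) ->
  forall k u, 0 < k -> f (k *: u) = k * f u.
Proof.
move=> fZ_le k u k0; apply/eqP; rewrite eq_le fZ_le//= -ler_pdivlMl//.
by have := fZ_le k^-1 (k *: u);
  rewrite scalerA mulVf ?gt_eqF// scale1r invr_gt0; exact.
Qed.

End euclidean.

Section support_function.
Context {R : realType} {m : nat}.
Variables (Z : set 'cV[R]_m) (al : R).
Hypothesis unit_ball_Z : forall z, l2norm z <= 1 -> Z z.
Hypothesis Z_bounded : forall z, Z z -> l2norm z <= al.
Implicit Types y z : 'cV[R]_m.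

Definition support_fun y : R := sup [set dot y z | z in Z].

Let Z0 : Z 0. Proof. by apply: unit_ball_Z; rewrite l2norm0. Qed.

Let has_sup_dot y : has_sup [set dot y z | z in Z].
Proof.
split; first by exists (dot y 0), 0.
exists (l2norm y * al) => _ [z Zz <-]; rewrite (le_trans (ler_norm _))//.
by rewrite (le_trans (norm_dot_le _ _))// ler_wpM2l ?l2norm_ge0// Z_bounded.
Qed.

Lemma dot_le_support_fun y z : Z z -> dot y z <= support_fun y.
Proof. by move=> Zz; apply: ub_le_sup; [exact: (has_sup_dot y).2|exists z]. Qed.

Lemma support_fun_le y (b : R) : (forall z, Z z -> dot y z <= b) ->
  support_fun y <= b.
Proof.
move=> Zb; apply: ge_sup; first exact: (has_sup_dot y).1.
by move=> _ [z Zz <-]; exact: Zb.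
Qed.

Lemma support_fun_near y (b : R) : b < support_fun y ->
  exists2 z, Z z & b < dot y z.
Proof.
by move=> /(sup_gt (has_sup_dot y).1)[_ [z Zz <-] bz]; exists z.
Qed.

Lemma l2norm_le_support_fun y : l2norm y <= support_fun y.
Proof.
have [->|y0] := eqVneq y 0.
  by rewrite l2norm0 -(@dot0l R m 0) dot_le_support_fun.
have ny0 := l2norm_gt0 y0.
have -> : l2norm y = dot y ((l2norm y)^-1 *: y).
  by rewrite dotZr -l2norm_sqr expr2 mulKf// gt_eqF.
apply: dot_le_support_fun; apply: unit_ball_Z.
by rewrite l2normZ ger0_norm ?invr_ge0 ?l2norm_ge0// mulVf// gt_eqF.
Qed.

Lemma support_funD y z : support_fun (y + z) <= support_fun y + support_fun z.
Proof.
by apply: support_fun_le => w Zw; rewrite dotDl lerD// dot_le_support_fun.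
Qed.

Lemma support_fun_le_l2norm y : support_fun y <= al * l2norm y.
Proof.
apply: support_fun_le => z Zz; rewrite (le_trans (ler_norm _))//.
rewrite (le_trans (norm_dot_le _ _))// mulrC.
by rewrite ler_wpM2r ?l2norm_ge0// Z_bounded.
Qed.

Lemma support_funZ (k : R) y : 0 < k ->
  support_fun (k *: y) = k * support_fun y.
Proof.
apply: homogeneous_of_le => {}k {}y k0; apply: support_fun_le => z Zz.
by rewrite dotZl ler_pM2l// dot_le_support_fun.
Qed.

End support_function.

Section norming.
Context {R : realType} {m : nat} {I : Type}.
Implicit Types (h : 'cV[R]_m -> R) (x : I -> 'cV[R]_m).

Definition norming (D : R) h x : Prop :=
  forall y, exists i, h y <= D * `|dot y (x i)|.

Lemma norming_perturbation (D e : R) h x x' : 0 <= D -> D * e <= 1 / 2 ->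
  (forall y, l2norm y <= h y) -> (forall i, l2norm (x' i - x i) <= e) ->
  norming D h x' -> norming (2 * D) h x.
Proof.
move=> D0 De hy xe hx' y; have [i yi] := hx' y; exists i.
have err : `|dot y (x' i)| <= `|dot y (x i)| + l2norm y * e.
  have -> : dot y (x' i) = dot y (x i) + dot y (x' i - x i).
    by rewrite dotBr; ring.
  rewrite (le_trans (ler_normD _ _))// lerD2l (le_trans (norm_dot_le _ _))//.
  by rewrite ler_wpM2l ?l2norm_ge0.
have : D * e * l2norm y <= 1 / 2 * h y.
  by rewrite (le_trans (ler_wpM2r (l2norm_ge0 y) De))// ler_wpM2l.
have : D * `|dot y (x' i)| <= D * `|dot y (x i)| + D * e * l2norm y.
  by rewrite -mulrA (mulrC e) -mulrDr ler_wpM2l.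
by rewrite -mulrA; lra.
Qed.

Lemma norming_of_unit (D : R) h x : inhabited I -> 0 <= D ->
  h 0 <= 0 -> (forall k y, 0 < k -> h (k *: y) = k * h y) ->
  (forall y, l2norm y = 1 -> exists i, h y <= D * `|dot y (x i)|) ->
  norming D h x.
Proof.
move=> [i0] D0 h0 hZ unit_case y; have [->|y0] := eqVneq y 0.
  by exists i0; rewrite (le_trans h0)// mulr_ge0.
have r0 := l2norm_gt0 y0; have rV0 : 0 < (l2norm y)^-1 by rewrite invr_gt0.
have [|i] := unit_case ((l2norm y)^-1 *: y).
  by rewrite l2normZ gtr0_norm// mulVf// gt_eqF.
by rewrite hZ// dotZl normrM gtr0_norm// mulrCA ler_pM2l//; exists i.
Qed.

End norming.

Section integer_l1_ball.
Context {R : realType}.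

Lemma sum_expR_geometric (n : nat) (A : R) : 0 < A ->
  \sum_(i < n) expR (- (i%:R / A)) <= 1 + A.
Proof.
move=> A0; pose t := expR (- A^-1); have t0 : 0 < t := expR_gt0 _.
have t1 : t < 1 by rewrite -expR0 ltr_expR oppr_lt0 invr_gt0.
have tA : (1 - t)^-1 <= 1 + A.
  have VA : (1 + A^-1) * t <= 1.
    by rewrite /t expRN ler_pdivrMr ?expR_gt0// mul1r expR_ge1Dx.
  rewrite -[leLHS]mul1r ler_pdivrMr ?subr_gt0//.
  by move: VA; rewrite -(ler_pM2l A0) mulrA mulrDr mulr1 mulfV ?gt_eqF//; lra.
apply: le_trans tA; rewrite -[leRHS]mul1r.
have := @geometric_le_lim R n 1 t ler01 t0.
rewrite (ger0_norm (ltW t0)) => /(_ t1).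
apply: le_trans; rewrite /series/= big_mkord; apply: ler_sum => i _.
by rewrite mul1r -expRM_natl mulrN.
Qed.

Lemma sum_expR_two_sided (B : nat) (A : R) : 0 < A ->
  \sum_(k < B + B.+1) expR (- (`|k%:R - B%:R| / A)) <= 1 + 2 * A.
Proof.
move=> A0; rewrite big_split_ord/= (reindex_inj rev_ord_inj)/=.
have := sum_expR_geometric B.+1 A0; rewrite big_ord_recl/= mul0r oppr0 expR0.
set S := \sum_(i < B) _ => S_le.
have -> : \sum_(i < B) expR (- (`|(B - i.+1)%:R - B%:R| / A)) = S.
  apply: eq_bigr => i _.
  by rewrite natrB// addrC addKr normrN ger0_norm.
have -> : \sum_(i < B.+1) expR (- (`|(B + i)%:R - B%:R| / A)) =
    \sum_(i < B.+1) expR (- (i%:R / A)).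
  by apply: eq_bigr => i _; rewrite natrD addrC addKr ger0_norm.
by have := sum_expR_geometric B.+1 A0; lra.
Qed.

Lemma integer_l1_ball_enum (I : finType) (A : R) : 0 < A ->
  exists s : seq {ffun I -> int},
    (size s)%:R <= (expR 1 * (1 + 2 * A)) ^+ #|I| /\
    forall k : {ffun I -> int}, \sum_i `|(k i)%:~R| <= A * #|I|%:R -> k \in s.
Proof.
move=> A0; pose B := (Num.truncn (A * #|I|%:R)).+1.
pose pt (n : {ffun I -> 'I_(B + B.+1)}) : {ffun I -> int} :=
  [ffun i => (n i)%:Z - B%:Z].
pose in_ball (k : {ffun I -> int}) := (\sum_i `|(k i)%:~R| <= A * #|I|%:R)%R.
exists [seq pt n | n <- enum [pred n | in_ball (pt n)]]; split.
  pose w (k : 'I_(B + B.+1)) : R := expR (1 - `|k%:R - B%:R| / A).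
  have wE : \sum_k w k =
      expR 1 * \sum_(k < B + B.+1) expR (- (`|k%:R - B%:R| / A)).
    by rewrite big_distrr/=; apply: eq_bigr => k _; rewrite -expRD.
  rewrite size_map -cardE -sum1_card natr_sum big_mkcond/=.
  apply: (@le_trans _ _ (\sum_(n : {ffun I -> 'I_(B + B.+1)}) \prod_i w (n i))).
    apply: ler_sum => n _; rewrite -expR_sum sumrB sumr_const -big_distrl/=.
    rewrite inE; case: ifP => [nA|_]; last exact: expR_ge0.
    rewrite -[leLHS]expR0 ler_expR subr_ge0 ler_pdivrMr// mulrC.
    move: nA; rewrite /in_ball; congr (_ <= _); apply: eq_bigr => i _.
    by rewrite ffunE intrB.
  rewrite -(bigA_distr_bigA (fun=> w))/= prodr_const lerXn2r ?nnegrE//.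
  - by apply: sumr_ge0 => k _; exact: expR_ge0.
  - by rewrite mulr_ge0 ?expR_ge0// addr_ge0// mulr_ge0// ltW.
  - by rewrite wE ler_pM2l ?expR_gt0// sum_expR_two_sided.
move=> k k_ball.
have kB i : (`|k i| < B)%N.
  rewrite -(ltr_nat R) natr_absz intr_norm (le_lt_trans _ (truncnS_gt _))//.
  by apply: le_trans k_ball; rewrite (bigD1 i)//= lerDl; apply: sumr_ge0.
have n_lt i : (absz (k i + B%:Z)%R < B + B.+1)%N by have := kB i; lia.
pose n := [ffun i => Ordinal (n_lt i)].
have ptn : pt n = k.
  by apply/ffunP => i; rewrite !ffunE/=; have := kB i; lia.
by apply/mapP; exists n; rewrite ?mem_enum ?inE ?ptn.
Qed.

End integer_l1_ball.

Section random_rounding.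
Context {R : realType} {m : nat}.

Definition lattice_pt (h : R) (k : {ffun 'I_m -> int}) : 'cV[R]_m :=
  \col_j (h * (k j)%:~R).

Lemma l1_lattice_pt_le (h : R) (y : 'cV[R]_m) k : 0 < h ->
  (forall j, `|(y - lattice_pt h k) j ord0| <= h) ->
  h * \sum_j `|(k j)%:~R| <= Num.sqrt m%:R * l2norm y + h * m%:R.
Proof.
move=> h0 yk; apply: le_trans (lerD (l1norm_le_l2norm y) (lexx _)).
rewrite mulr_natr -[m in _ *+ m]card_ord -sumr_const -big_split big_distrr/=.
apply: ler_sum => j _.
rewrite -[X in X * _](gtr0_norm h0) -normrM addrC -lerBlDr.
by rewrite (le_trans (lerB_dist _ _))// distrC; have := yk j; rewrite !mxE.
Qed.

Variables (h : R) (y : 'cV[R]_m).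
Hypothesis h_gt0 : 0 < h.

Definition grid_floor j : int := Num.floor (y j ord0 / h).

Definition grid_frac j : R := y j ord0 / h - (grid_floor j)%:~R.

Definition rounding_weight j (up : bool) : R :=
  if up then grid_frac j else 1 - grid_frac j.

Definition rounded (e : {ffun 'I_m -> bool}) : {ffun 'I_m -> int} :=
  [ffun j => grid_floor j + e j].

Lemma grid_frac01 j : 0 <= grid_frac j <= 1.
Proof.
rewrite subr_ge0 floor_le lerBlDr addrC ltW//.
by rewrite [ltRHS](_ : _ = (grid_floor j + 1)%:~R) ?floorD1_gt// intrD.
Qed.

Lemma rounding_weight_pmf j : is_pmf (rounding_weight j).
Proof.
have /andP[r0 r1] := grid_frac01 j; split=> [[]|].
- exact: r0.
- by rewrite /= subr_ge0.
- by rewrite big_bool/= addrC subrK.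
Qed.

Lemma rounding_errorE e j :
  (y - lattice_pt h (rounded e)) j ord0 = h * (grid_frac j - (e j)%:R).
Proof.
by rewrite !mxE ffunE intrD /grid_frac -pmulrn; field; rewrite gt_eqF.
Qed.

Lemma rounding_error_le e j : `|(y - lattice_pt h (rounded e)) j ord0| <= h.
Proof.
rewrite rounding_errorE normrM gtr0_norm// ler_piMr ?(ltW h_gt0)//.
have /andP[r0 r1] := grid_frac01 j.
by case: (e j) => /=; rewrite ler_norml; lra.
Qed.

Lemma mean_rounding_error (u : 'cV[R]_m) :
  mean (prodw rounding_weight)
    (fun e => dot u (y - lattice_pt h (rounded e)) ^+ 2)
  <= h ^+ 2 * dot u u.
Proof.
pose g j (b : bool) := u j ord0 * (h * (grid_frac j - b%:R)).
have dot_errorE e :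
    dot u (y - lattice_pt h (rounded e)) ^+ 2 = (\sum_j g j (e j)) ^+ 2.
  by congr (_ ^+ 2); apply: eq_bigr => j _; rewrite rounding_errorE.
rewrite (eq_mean _ dot_errorE).
apply: (le_trans (mean_prodw_sqr_sum rounding_weight_pmf g)).
rewrite [X in _ + X ^+ 2]big1 ?expr0n ?addr0/= => [|j _]; last first.
  by rewrite /mean big_bool /g/=; ring.
rewrite /dot big_distrr/=; apply: ler_sum => j _; rewrite /mean big_bool /g/=.
have /andP[r0 r1] := grid_frac01 j; move: (grid_frac j) r0 r1 => r r0 r1.
move: (u j ord0) => c.
rewrite [leLHS](_ : _ = r * (1 - r) * (h ^+ 2 * (c * c))); last by ring.
rewrite ler_piMl//; first by rewrite -expr2 mulr_ge0 ?sqr_ge0.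
by have := sqr_ge0 r; lra.
Qed.

Lemma exists_rounding (I : finType) (X : I -> 'cV[R]_m) (good : pred I)
    (L t : R) :
  0 <= L -> 0 < t -> (forall i, good i -> dot (X i) (X i) <= L) ->
  exists k : {ffun 'I_m -> int},
    (forall j, `|(y - lattice_pt h k) j ord0| <= h) /\
    \sum_i (good i && (t <= `|dot (X i) (y - lattice_pt h k)|)%R)%:R
      <= #|I|%:R * (h ^+ 2 * L / t ^+ 2).
Proof.
move=> L0 t0 XL.
pose far i e := good i && (t <= `|dot (X i) (y - lattice_pt h (rounded e))|)%R.
have w_pmf := prodw_pmf rounding_weight_pmf.
have [e e_le] := exists_le_mean w_pmf (fun e => \sum_i (far i e)%:R : R).
exists (rounded e); split; first exact: rounding_error_le.
apply: (le_trans e_le); rewrite mean_sum mulr_natl -sumr_const.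
apply: ler_sum => i _; rewrite -/(prob _ (far i)) /far.
have [gi|_] := boolP (good i); last first.
  by rewrite /prob/= mean_cst// divr_ge0 ?sqr_ge0// mulr_ge0 ?sqr_ge0.
have sqr_far e' : (t ^+ 2 <= dot (X i) (y - lattice_pt h (rounded e')) ^+ 2) =
    (t <= `|dot (X i) (y - lattice_pt h (rounded e'))|).
  by rewrite -[X in _ <= X]real_normK ?num_real// ler_pXn2r ?nnegrE// ltW.
under [leLHS]eq_mean do rewrite /= -sqr_far.
apply: (le_trans (prob_markov w_pmf.1 (exprn_gt0 2 t0) _)) => [e'|];
  first exact: sqr_ge0.
rewrite ler_pM2r ?invr_gt0 ?exprn_gt0// (le_trans (mean_rounding_error _))//.
by rewrite ler_wpM2l ?sqr_ge0// XL.
Qed.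

End random_rounding.

Section uniform_small_ball.
Context {R : realType}.
Variables (m N : nat) (U : finType) (Q : U -> R) (X : U -> 'cV[R]_m).
Variables (h : 'cV[R]_m -> R) (al kappa p : R).
Hypotheses (m_gt0 : (0 < m)%N) (N_gt0 : (0 < N)%N).
Hypothesis Q_pmf : is_pmf Q.
Hypothesis X_sqr : mean Q (fun u => dot (X u) (X u)) <= m%:R.
Hypothesis h_ge : forall y, l2norm y <= h y.
Hypothesis h_le : forall y, h y <= al * l2norm y.
Hypothesis hD : forall y z, h (y + z) <= h y + h z.
Hypothesis hZ : forall k y, 0 < k -> h (k *: y) = k * h y.
Hypotheses (p_gt0 : 0 < p) (p_al : p * al <= 1) (kappa01 : 0 < kappa <= 1).
Hypothesis small_ball :
  forall y, y != 0 -> p <= prob Q (fun u => kappa * h y <= dot y (X u)).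
Hypothesis p_ratio : 96 <= p * (N%:R / m%:R).
Hypothesis p_ratio_exp :
  expR 4 * (3 + 96 / (p * kappa)) <= expR (p * (N%:R / m%:R) / 4).

Let kappa_gt0 : 0 < kappa. Proof. by case/andP: kappa01. Qed.
Let mR_gt0 : 0 < m%:R :> R. Proof. by rewrite ltr0n. Qed.
Let sqrtm_gt0 : 0 < Num.sqrt m%:R :> R. Proof. by rewrite sqrtr_gt0. Qed.
Let NE : N%:R = N%:R / m%:R * m%:R :> R. Proof. by rewrite divfK// gt_eqF. Qed.
Let h0 : h 0 <= 0. Proof. by rewrite (le_trans (h_le 0))// l2norm0 mulr0. Qed.

Definition net_eps : R := p * kappa / 48.
Definition mesh : R := net_eps / Num.sqrt m%:R.
Definition sqr_cutoff : R := 32 / p * m%:R.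
Definition oversized (u : U) : bool := sqr_cutoff <= dot (X u) (X u).
Definition correlated (xi : 'cV[R]_m) (u : U) : bool :=
  kappa * h xi <= dot xi (X u).
Definition many_oversized (v : {ffun 'I_N -> U}) : bool :=
  p * N%:R / 8 <= occurrences (fun=> oversized) v.
Definition missed (k : {ffun 'I_m -> int}) (v : {ffun 'I_N -> U}) : bool :=
  (lattice_pt mesh k != 0) &&
    (occurrences (fun=> correlated (lattice_pt mesh k)) v <= p * N%:R / 4).

Let eps_gt0 : 0 < net_eps. Proof. by rewrite divr_gt0// mulr_gt0. Qed.
Let mesh_gt0 : 0 < mesh. Proof. by rewrite divr_gt0. Qed.
Let cutoff_gt0 : 0 < sqr_cutoff. Proof. by rewrite mulr_gt0// divr_gt0. Qed.
Let mesh_sqrtm : mesh * Num.sqrt m%:R = net_eps.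
Proof. by rewrite divfK// gt_eqF. Qed.

Lemma prob_many_oversized :
  prob (prodw (fun=> Q)) many_oversized <= expR (- (3 * m%:R)).
Proof.
have prob_oversized : prob Q oversized <= p / 32.
  apply: (le_trans (prob_markov Q_pmf.1 cutoff_gt0 (fun u => dot_ge0 (X u)))).
  rewrite ler_pdivrMr// (le_trans X_sqr)// [leRHS](_ : _ = m%:R)//.
  by rewrite /sqr_cutoff; field; rewrite gt_eqF.
have sum_oversized : \sum_(i < N) prob Q oversized <= p / 32 * N%:R.
  by rewrite sumr_const card_ord -[leLHS]mulr_natr ler_wpM2r.
apply: (le_trans (occurrences_upper_tail _ _ sum_oversized)) => //.
by rewrite ler_expR NE; move: mR_gt0 p_ratio; nra.
Qed.

Lemma prob_missed k :
  prob (prodw (fun=> Q)) (missed k) <= expR (- (p * N%:R / 4)).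
Proof.
rewrite /missed; have [xi0|xi0] := eqVneq (lattice_pt mesh k) 0.
  by rewrite /prob/= (mean_cst (prodw_pmf _)) ?expR_ge0.
have sum_correlated :
    p * N%:R <= \sum_(i < N) prob Q (correlated (lattice_pt mesh k)).
  by rewrite sumr_const card_ord -[leRHS]mulr_natr ler_wpM2r// small_ball.
by rewrite (le_trans (occurrences_lower_tail _ _ sum_correlated))// ler_expR;
  lra.
Qed.

Lemma prob_net_missed (s : seq {ffun 'I_m -> int}) :
  (size s)%:R <= (expR 1 * (1 + 2 * (1 + net_eps^-1))) ^+ m ->
  prob (prodw (fun=> Q)) (fun v => has (missed^~ v) s) <= expR (- (3 * m%:R)).
Proof.
move=> s_size.
have Q_ge0 v : 0 <= prodw (fun _ : 'I_N => Q) v by exact: prodw_ge0.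
apply: (le_trans (prob_has Q_ge0 _ _)).
apply: (@le_trans _ _ ((size s)%:R * expR (- (p * N%:R / 4)))).
  rewrite -sum1_size natr_sum big_distrl/=.
  by apply: ler_sum => k _; rewrite mul1r prob_missed.
rewrite expRN ler_pdivrMr ?expR_gt0// (le_trans s_size)// -expRD.
have -> : - (3 * m%:R) + p * N%:R / 4 = (p * (N%:R / m%:R) / 4 - 3) * m%:R.
  by rewrite [in LHS]NE; lra.
rewrite expRM_natr lerXn2r ?nnegrE ?expR_ge0//.
  rewrite mulr_ge0 ?expR_ge0// !addr_ge0// mulr_ge0// addr_ge0// invr_ge0.
  exact: ltW.
rewrite expRB ler_pdivlMr ?expR_gt0//; apply: le_trans p_ratio_exp.
rewrite mulrAC -expRD (_ : 1 + 3 = 4); last by lra.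
rewrite ler_pM2l ?expR_gt0// [leRHS](_ : _ = 1 + 2 * (1 + net_eps^-1))//.
by rewrite /net_eps; field; rewrite !gt_eqF.
Qed.

Lemma seminorm_near_unit y xi : l2norm y = 1 -> l2norm (y - xi) <= net_eps ->
  47 / 48 * h y <= h xi.
Proof.
move=> y1 y_xi; have : 1 <= h y by rewrite -y1.
have : h y <= h xi + h (y - xi) by rewrite (le_trans _ (hD _ _))// addrC subrK.
suff : h (y - xi) <= 1 / 48 by lra.
have [al0|/ltW al0] := leP 0 al; last first.
  by rewrite (le_trans (h_le _))// (le_trans (mulr_le0_ge0 al0 (l2norm_ge0 _))).
rewrite (le_trans (h_le _))// (le_trans (ler_wpM2l al0 y_xi))// /net_eps.
rewrite !mulrA ler_wpM2r ?invr_ge0// (mulrC al).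
by have /andP[k0 k1] := kappa01; rewrite mulr_ile1// ?mulr_ge0// ltW.
Qed.

Lemma correlated_far y xi u : 0 < h y -> 47 / 48 * h y <= h xi ->
  `|dot y (X u)| < kappa * h y / 3 -> correlated xi u ->
  kappa * h y / 3 <= `|dot (X u) (y - xi)|.
Proof.
move=> hy y_xi small corr_xi; rewrite ler_normr dotBr opprB !(dotC (X u)).
apply/orP; right; move: corr_xi small; rewrite /correlated ltr_norml.
move=> corr_xi /andP[_ small].
have : kappa * (47 / 48 * h y) <= kappa * h xi by rewrite ler_wpM2l// ltW.
have : 0 < kappa * h y by rewrite mulr_gt0.
by lra.
Qed.

Lemma unit_vector_detected (s : seq {ffun 'I_m -> int})
    (v : {ffun 'I_N -> U}) y :
  (forall k : {ffun 'I_m -> int},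
     \sum_j `|(k j)%:~R| <= (1 + net_eps^-1) * m%:R -> k \in s) ->
  ~~ many_oversized v -> ~~ has (missed^~ v) s -> l2norm y = 1 ->
  exists i, h y <= 3 / kappa * `|dot y (X (v i))|.
Proof.
move=> s_net few_oversized no_miss y1; apply: contrapT => /forallNP all_small.
have hy1 : 1 <= h y by rewrite -y1.
pose t := kappa * h y / 3.
have t0 : 0 < t by rewrite divr_gt0// mulr_gt0//; lra.
have {}all_small i : `|dot y (X (v i))| < t.
  rewrite ltNge /t ler_pdivrMr//; apply/negP => ty; apply: (all_small i).
  by rewrite mulrAC ler_pdivlMr// mulrC [leRHS]mulrC.
have [i|k [yk few_far]] := exists_rounding (X := fun i => X (v i)) y mesh_gt0
    (good := fun i => ~~ oversized (v i)) (ltW cutoff_gt0) t0.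
  by rewrite /oversized -ltNge => /ltW.
have k_s : k \in s.
  apply: s_net; rewrite -(ler_pM2l mesh_gt0).
  rewrite (le_trans (l1_lattice_pt_le mesh_gt0 yk))// y1 mulr1 addrC.
  rewrite [leRHS](_ : _ = mesh * m%:R + m%:R / Num.sqrt m%:R); last first.
    by rewrite /mesh; field; rewrite !gt_eqF.
  by rewrite lerD2l -[X in X / _](sqr_sqrtr (ler0n R m)) expr2 mulfK ?gt_eqF.
set xi := lattice_pt mesh k in yk few_far.
have hxi : 47 / 48 * h y <= h xi.
  by apply: seminorm_near_unit => //; rewrite -mesh_sqrtm l2norm_le_coord// ltW.
have xi0 : xi != 0.
  by apply/eqP => xi0; move: hxi; rewrite xi0; move: h0 hy1; lra.
have many_correlated : p * N%:R / 4 < occurrences (fun=> correlated xi) v.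
  move: no_miss; rewrite -all_predC => /allP/(_ k k_s).
  by rewrite /= /missed xi0 -ltNge.
have : occurrences (fun=> correlated xi) v <= occurrences (fun=> oversized) v +
    \sum_(i < N) (~~ oversized (v i) &&
      (t <= `|dot (X (v i)) (y - xi)|)%R)%:R :> R.
  rewrite /occurrences -big_split/=; apply: ler_sum => i _ /=.
  have [corr_i|_] := boolP (correlated xi (v i)); last by rewrite addr_ge0.
  rewrite (@correlated_far y)// ?andbT; last by lra.
  by case: (oversized _); rewrite ?addr0 ?add0r.
suff : #|'I_N|%:R * (mesh ^+ 2 * sqr_cutoff / t ^+ 2) <= p * N%:R / 8.
  by move: few_oversized few_far many_correlated;
    rewrite /many_oversized -ltNge; lra.
rewrite card_ord [leLHS](_ : _ = p * N%:R / 8 / h y ^+ 2); last first.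
  rewrite /t /mesh expr_div_n sqr_sqrtr ?ler0n// /net_eps /sqr_cutoff.
  by field; rewrite !gt_eqF//; lra.
have pN0 : 0 <= p * N%:R / 8 by rewrite divr_ge0// mulr_ge0// ltW.
by rewrite ler_piMr// invf_le1 ?exprn_ege1// exprn_gt0//; lra.
Qed.

Lemma prob_not_norming :
  prob (prodw (fun=> Q)) (fun v : {ffun 'I_N -> U} =>
    ~~ `[< norming (3 / kappa) h (fun i => X (v i)) >]) <= expR (- (2 * m%:R)).
Proof.
have A_gt0 : 0 < 1 + net_eps^-1 by rewrite addr_gt0// invr_gt0.
have [s [s_size s_net]] := integer_l1_ball_enum 'I_m A_gt0.
rewrite card_ord in s_size s_net.
have Q_ge0 v : 0 <= prodw (fun _ : 'I_N => Q) v by exact: prodw_ge0.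
apply: (@le_trans _ _ (2 * expR (- (3 * m%:R)))).
  apply: (@le_trans _ _ (prob (prodw (fun=> Q))
      (fun v => many_oversized v || has (missed^~ v) s))).
    apply: ler_prob => // v; apply: contraNT; rewrite negb_or.
    move=> /andP[few_oversized no_miss].
    apply/asboolP; apply: norming_of_unit => // [||y y1].
    - exact: inhabits (Ordinal N_gt0).
    - by rewrite divr_ge0// ltW.
    - exact: (unit_vector_detected s_net).
  apply: (le_trans (prob_or Q_ge0 _ _)).
  by rewrite mulr_natl mulr2n lerD// ?prob_many_oversized// prob_net_missed.
rewrite (_ : - (2 * m%:R) = m%:R + - (3 * m%:R)); last by lra.
rewrite expRD ler_wpM2r ?expR_ge0//; apply: le_trans (expR_ge1Dx _).
by rewrite -[2]/(1 + 1) lerD2l ler1n.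
Qed.

End uniform_small_ball.

Section small_ball_of_tilts.
Context {R : realType} {m : nat} {V : finType}.
Variables (q x : V -> R) (Z : set 'cV[R]_m) (al C c s B : R).
Hypotheses (q_pmf : is_pmf q) (x_sqr : mean q (fun a => x a ^+ 2) <= 1).
Hypothesis unit_ball_Z : forall z, l2norm z <= 1 -> Z z.
Hypothesis Z_bounded : forall z, Z z -> l2norm z <= al.
Hypotheses (C0 : 0 <= C) (c0 : 0 < c) (s0 : 0 < s) (B0 : 0 <= B).
Hypothesis Z_tilt : forall z, Z z -> forall j,
  tiltable q x C c B (s * z j ord0).

Definition column (u : {ffun 'I_m -> V}) : 'cV[R]_m := \col_j x (u j).

Let q_pmfs (j : 'I_m) : is_pmf q. Proof. exact: q_pmf. Qed.
Let cs0 : 0 < c * s. Proof. exact: mulr_gt0. Qed.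

Lemma mean_sqr_column :
  mean (prodw (fun=> q)) (fun u => dot (column u) (column u)) <= m%:R.
Proof.
rewrite mean_sum -[m in _ <= m%:R]card_ord -sumr_const; apply: ler_sum => j _.
rewrite (@eq_mean _ _ _ _ (fun u : {ffun 'I_m -> V} => x (u j) ^+ 2)) => [|u].
  by rewrite (mean_prodw_coord q_pmfs j (fun a => x a ^+ 2)).
by rewrite mxE expr2.
Qed.

Lemma support_fun_small_ball y : y != 0 ->
  (4 * (1 + B * (4 / (c * s) ^+ 2))) ^- 2 * expR (- (C * (s ^+ 2 * al ^+ 2))) <=
  prob (prodw (fun=> q))
    (fun u => c * s / 4 * support_fun Z y <= dot y (column u)).
Proof.
move=> y0; have y_pos := l2norm_gt0 y0.
have y_supp := l2norm_le_support_fun unit_ball_Z Z_bounded y.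
have half : support_fun Z y / 2 < support_fun Z y by lra.
have [z Zz yz] := support_fun_near unit_ball_Z Z_bounded half.
have ME : c * \sum_j y j ord0 * (s * z j ord0) = c * s * dot y z.
  by rewrite -mulrA -dotZr; congr (_ * _); apply: eq_bigr => j _; rewrite mxE.
have z_sqr : \sum_j (s * z j ord0) ^+ 2 <= s ^+ 2 * al ^+ 2.
  rewrite [leLHS](_ : _ = s ^+ 2 * l2norm z ^+ 2).
    rewrite ler_wpM2l ?sqr_ge0// lerXn2r ?nnegrE ?l2norm_ge0 ?Z_bounded//.
    by rewrite (le_trans _ (Z_bounded Zz)) ?l2norm_ge0.
  by rewrite l2norm_sqr /dot big_distrr/=; apply: eq_bigr => j _; ring.
have M0 : 0 < c * s * dot y z by rewrite mulr_gt0//; lra.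
have y_sqr : \sum_j y j ord0 ^+ 2 <= 4 / (c * s) ^+ 2 * (c * s * dot y z) ^+ 2.
  rewrite [leRHS](_ : _ = (2 * dot y z) ^+ 2); last by field; rewrite !gt_eqF.
  rewrite [leLHS](_ : _ = l2norm y ^+ 2); last first.
    by rewrite l2norm_sqr; apply: eq_bigr => j _; rewrite expr2.
  by rewrite lerXn2r ?nnegrE//; lra.
apply: (@le_trans _ _ ((4 * (1 + B * (4 / (c * s) ^+ 2))) ^- 2 *
    expR (- (C * \sum_j (s * z j ord0) ^+ 2)))).
  by rewrite ler_wpM2l ?invr_ge0 ?sqr_ge0// ler_expR lerN2 ler_wpM2l.
have := @tilted_lower_tail R V 'I_m q x C c B (4 / (c * s) ^+ 2) (y^~ ord0)
  (fun j => s * z j ord0) q_pmf B0 (Z_tilt Zz).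
rewrite /= ME => /(_ M0 y_sqr)/le_trans; apply; apply: ler_prob => [|u].
  exact: prodw_ge0.
have -> : \sum_j y j ord0 * x (u j) = dot y (column u).
  by apply: eq_bigr => j _; rewrite mxE.
by apply: le_trans; rewrite -!mulrA ler_pM2l// ler_pM2l//; lra.
Qed.

End small_ball_of_tilts.

Section small_ball_constants.
Context {R : realType}.
Implicit Types (C c k kappa rho : R).

(* The factor 6 keeps the cube of the cost [expR (C * (tilt_scale C * al) ^+ 2)]
   of a tilt below [expR (al ^+ 2 / 2)], which is [sqrt (e * N / m)]. *)
Definition tilt_scale C : R := (6 * C)^-1.

Definition tilt_bound C al : R := 2 * expR (C * (tilt_scale C ^+ 2 * al ^+ 2)).

Definition small_ball_const C c : R :=
  (4 * (1 + 8 / (c * tilt_scale C) ^+ 2)) ^- 2.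

Lemma tilt_scale_gt0 C : 1 <= C -> 0 < tilt_scale C.
Proof. by move=> C1; rewrite invr_gt0; lra. Qed.

Lemma tilt_scale_le1 C : 1 <= C -> tilt_scale C <= 1.
Proof. by move=> C1; rewrite invf_le1; lra. Qed.

Lemma tilt_bound_ge2 C al : 1 <= C -> 2 <= tilt_bound C al.
Proof.
move=> C1; rewrite -[leLHS]mulr1 ler_pM2l// -[leLHS]expR0 ler_expR.
by rewrite mulr_ge0 ?(le_trans ler01 C1)// -exprMn sqr_ge0.
Qed.

Let small_ball_den_ge1 C c : 1 <= 4 * (1 + 8 / (c * tilt_scale C) ^+ 2).
Proof.
have : 0 <= 8 / (c * tilt_scale C) ^+ 2 by rewrite divr_ge0 ?sqr_ge0.
by lra.
Qed.

Lemma small_ball_const_gt0 C c : 0 < small_ball_const C c.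
Proof. by rewrite invr_gt0 exprn_gt0// (lt_le_trans ltr01). Qed.

Lemma small_ball_const_le1 C c : small_ball_const C c <= 1.
Proof. by rewrite invf_le1 ?exprn_gt0 ?(lt_le_trans ltr01)// exprn_ege1. Qed.

Lemma small_ball_const_le C c (al : R) : 1 <= C ->
  small_ball_const C c * expR (- (al ^+ 2 / 2)) <=
  (4 * (1 + tilt_bound C al * (4 / (c * tilt_scale C) ^+ 2))) ^- 2 *
    expR (- (C * (tilt_scale C ^+ 2 * al ^+ 2))).
Proof.
move=> C1; rewrite /tilt_bound; set E := expR (C * _).
have E1 : 1 <= E.
  rewrite -[leLHS]expR0 ler_expR mulr_ge0 ?(le_trans ler01 C1)//.
  by rewrite -exprMn sqr_ge0.
have E0 : 0 < E by exact: expR_gt0.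
have E3 : E ^+ 3 <= expR (al ^+ 2 / 2).
  rewrite -expRM_natl ler_expR /tilt_scale.
  rewrite [leLHS](_ : _ = (6 * C)^-1 * (al ^+ 2 / 2)); last first.
    by field; rewrite gt_eqF//; lra.
  by rewrite ler_piMl ?tilt_scale_le1// divr_ge0// sqr_ge0.
rewrite !expRN -/E /small_ball_const; set r := 8 / _.
have r0 : 0 <= r by rewrite divr_ge0 ?sqr_ge0.
have -> : 2 * E * (4 / (c * tilt_scale C) ^+ 2) = E * r by rewrite /r; ring.
have Er0 : 0 <= E * r by rewrite mulr_ge0// ltW.
rewrite -!invfM lef_pV2 ?posrE ?mulr_gt0 ?exprn_gt0 ?expR_gt0//; try by lra.
apply: le_trans (ler_wpM2l (sqr_ge0 _) E3).
rewrite [leRHS](_ : _ = (4 * (1 + r) * E) ^+ 2 * E); last by ring.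
by rewrite ler_pM2r// lerXn2r ?nnegrE//; nra.
Qed.

Lemma linear_le_expR (a b : R) : 0 < b ->
  exists g0 : R, forall g, g0 <= g -> 0 <= g -> a * g <= expR (b * g).
Proof.
move=> b0; exists (2 * a / b ^+ 2) => g.
rewrite ler_pdivrMr ?exprn_gt0// => ag g0.
have bg0 : 0 <= b * g by rewrite mulr_ge0// ltW.
apply: le_trans (expR_ge1Dxn 1 bg0); rewrite -[2`!]/2%N.
suff : 2 * a * g <= (b * g) ^+ 2 by lra.
by rewrite [leRHS](_ : _ = g * b ^+ 2 * g) ?ler_wpM2r//; ring.
Qed.

Lemma aspect_ratio_threshold k kappa : 0 < k -> 0 < kappa ->
  exists Ct : R, forall rho, Ct <= rho -> 1 <= rho ->
    let p := k / Num.sqrt (expR 1 * rho) in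
    96 <= p * rho /\ expR 4 * (3 + 96 / (p * kappa)) <= expR (p * rho / 4).
Proof.
move=> k0 kappa0; pose e : R := expR 1; have e0 : 0 < e := expR_gt0 _.
have b0 : 0 < k / (4 * e) by rewrite divr_gt0// mulr_gt0.
have [g0 g0P] := linear_le_expR (expR 4 * (3 + 96 / (k * kappa))) b0.
pose g1 := Num.max g0 (96 * e / k); exists (g1 ^+ 2) => rho g1rho rho1.
have erho : 0 < e * rho by rewrite mulr_gt0//; lra.
set g := Num.sqrt (e * rho); have g_gt0 : 0 < g by rewrite sqrtr_gt0.
have g2 : g ^+ 2 = e * rho by rewrite sqr_sqrtr// ltW.
have e1 : 1 <= e by rewrite -[leLHS]expR0 ler_expR.
have g_ge1 : 1 <= g.
  by rewrite -sqrtr1 ler_wsqrtr// (le_trans rho1)// ler_peMl//; lra.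
have : g1 <= g.
  rewrite (le_trans (ler_norm _))// -sqrtr_sqr ler_wsqrtr// (le_trans g1rho)//.
  by rewrite ler_peMl//; lra.
rewrite ge_max => /andP[/g0P lin]; rewrite ler_pdivrMr// => gk p.
have prho : p * rho = g * k / e.
  have -> : rho = g ^+ 2 / e by rewrite g2 mulrC mulKf// gt_eqF.
  by rewrite /p -/g; field; rewrite !gt_eqF.
split; first by rewrite prho ler_pdivlMr.
rewrite prho (_ : g * k / e / 4 = k / (4 * e) * g); last first.
  by field; rewrite gt_eqF.
apply: le_trans (lin (ltW g_gt0)); rewrite -[leRHS]mulrA ler_pM2l ?expR_gt0//.
have -> : 96 / (p * kappa) = 96 / (k * kappa) * g.
  by rewrite /p -/g; field; rewrite !gt_eqF.
by rewrite [leRHS]mulrDl lerD2r ler_peMr.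
Qed.

End small_ball_constants.

Section iid_matrix.
Context {R : realType}.

Definition clip_level (m N : nat) : R := Num.sqrt (ln (expR 1 * N%:R / m%:R)).

Lemma ratio_ge1 (m N : nat) : (0 < m <= N)%N -> 1 <= N%:R / m%:R :> R.
Proof. by move=> /andP[m0 mN]; rewrite ler_pdivlMr ?ltr0n// mul1r ler_nat. Qed.

Lemma leq_of_ratio (Ct : R) (m N : nat) :
  1 <= Ct -> Ct * m%:R <= N%:R -> (m <= N)%N.
Proof. by move=> Ct1 CtN; rewrite -(ler_nat R) (le_trans _ CtN)// ler_peMl. Qed.

Lemma clip_level_sqr (m N : nat) : (0 < m <= N)%N ->
  clip_level m N ^+ 2 = 1 + ln (N%:R / m%:R).
Proof.
move=> /ratio_ge1 ratio1; rewrite /clip_level -mulrA.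
rewrite lnM ?posrE ?expR_gt0 ?(lt_le_trans ltr01)// expRK.
by rewrite sqr_sqrtr// addr_ge0 ?ln_ge0.
Qed.

Lemma clip_level_ge1 (m N : nat) : (0 < m <= N)%N -> 1 <= clip_level m N.
Proof.
move=> mN; rewrite -(@ler_pXn2r _ 2)// ?nnegrE ?sqrtr_ge0//.
by rewrite expr1n clip_level_sqr// lerDl ln_ge0// ratio_ge1.
Qed.

Lemma clip_level_gt0 (m N : nat) : (0 < m <= N)%N -> 0 < clip_level m N.
Proof. by move=> /clip_level_ge1; exact: lt_le_trans. Qed.

Lemma expR_clip_level (m N : nat) : (0 < m <= N)%N ->
  expR (- (clip_level m N ^+ 2 / 2)) = (Num.sqrt (expR 1 * (N%:R / m%:R)))^-1.
Proof.
move=> mN.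
have ratio0 : 0 < N%:R / m%:R :> R by apply: lt_le_trans (ratio_ge1 mN).
rewrite clip_level_sqr// expRN; congr _^-1.
apply/eqP; rewrite -(@eqrXn2 _ 2)// ?expR_ge0 ?sqrtr_ge0//.
rewrite sqr_sqrtr; last by rewrite mulr_ge0 ?expR_ge0 ?(ltW ratio0).
by rewrite -expRM_natl mulrCA mulfV// mulr1 expRD lnK// posrE.
Qed.

Lemma iid_matrix_norming (C c : R) : 1 <= C -> 0 < c <= 1 ->
  exists Ct : R,
  forall (m N : nat) (V : finType) (q x : V -> R) (Z : set 'cV[R]_m),
  (0 < m <= N)%N -> Ct * m%:R <= N%:R ->
  is_pmf q -> mean q (fun a => x a ^+ 2) <= 1 ->
  (forall z, l2norm z <= 1 -> Z z) ->
  (forall z, Z z -> l2norm z <= clip_level m N) ->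
  (forall z, Z z -> forall j,
    tiltable q x C c (tilt_bound C (clip_level m N))
      (tilt_scale C * z j ord0)) ->
  prob (prodw (fun=> prodw (fun=> q)))
    (fun v : {ffun 'I_N -> {ffun 'I_m -> V}} =>
      ~~ `[< norming (12 / (c * tilt_scale C)) (support_fun Z)
               (fun i => column x (v i)) >])
  <= expR (- (2 * m%:R)).
Proof.
move=> C1 /andP[c0 c1]; have s0 := tilt_scale_gt0 C1.
have s1 := tilt_scale_le1 C1.
have cs0 : 0 < c * tilt_scale C by rewrite mulr_gt0.
pose kappa := c * tilt_scale C / 4.
have kappa0 : 0 < kappa by rewrite divr_gt0.
have kappa1 : kappa <= 1.
  have := mulr_ile1 (ltW c0) (ltW s0) c1 s1; rewrite /kappa; lra.
have [Ct CtP] := aspect_ratio_threshold (small_ball_const_gt0 C c) kappa0.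
exists Ct => m N V q x Z mN CtN q_pmf x_sqr unit_Z Z_bounded Z_tilt.
have /andP[m0 mleN] := mN; have mR0 : 0 < m%:R :> R by rewrite ltr0n.
have [||p_ratio p_exp] := CtP (N%:R / m%:R).
- by rewrite ler_pdivlMr.
- exact: ratio_ge1.
set al := clip_level m N in Z_bounded Z_tilt.
have pE : small_ball_const C c / Num.sqrt (expR 1 * (N%:R / m%:R)) =
    small_ball_const C c * expR (- (al ^+ 2 / 2)) by rewrite expR_clip_level.
rewrite pE in p_ratio p_exp; set p := small_ball_const C c * _ in p_ratio p_exp.
have p0 : 0 < p by rewrite mulr_gt0 ?small_ball_const_gt0 ?expR_gt0.
have p_al : p * al <= 1.
  have al_le : al <= expR (al ^+ 2 / 2).
    apply: le_trans (expR_ge1Dx _).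
    by have := sqr_ge0 (al - 1); rewrite sqrrB; lra.
  rewrite /p expRN mulrAC ler_pdivrMr ?expR_gt0// mul1r (le_trans _ al_le)//.
  by rewrite ler_piMl ?sqrtr_ge0// small_ball_const_le1.
have -> : 12 / (c * tilt_scale C) = 3 / kappa.
  by rewrite /kappa; field; rewrite !gt_eqF.
apply: (@prob_not_norming R m N _ _ (column x) _ al kappa p) => //.
- exact: leq_trans mleN.
- exact: prodw_pmf.
- exact: mean_sqr_column.
- exact: (l2norm_le_support_fun unit_Z Z_bounded).
- exact: (support_fun_le_l2norm unit_Z Z_bounded).
- exact: (support_funD unit_Z Z_bounded).
- exact: (support_funZ unit_Z Z_bounded).
- by rewrite kappa0.
move=> y y0; apply: (le_trans (small_ball_const_le c al C1)).
apply: (support_fun_small_ball q_pmf unit_Z Z_bounded) => //.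
- exact: le_trans C1.
- by rewrite (le_trans _ (tilt_bound_ge2 al C1)).
Qed.

End iid_matrix.

Section l1_duality.
Context {R : realType}.

Definition l1_ball (N : nat) (r : R) : set 'rV[R]_N :=
  [set u | l1norm u^T <= r].

Lemma l1norm_tr (N : nat) (u : 'rV[R]_N) : l1norm u^T = \sum_i `|u ord0 i|.
Proof. by apply: eq_bigr => i _; rewrite mxE. Qed.

Lemma continuous_sum (T : topologicalType) (I : finType) (F : I -> T -> R) :
  (forall i, continuous (F i)) -> continuous (fun t => \sum_i F i t).
Proof. by move=> Fc; apply: continuous_big => //; exact: add_continuous. Qed.

Lemma compact_l1_ball (N : nat) (r : R) : compact (@l1_ball N r).
Proof.
have coord_le (u : 'rV[R]_N) i : l1_ball r u -> `|u ord0 i| <= r.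
  by rewrite /l1_ball/= l1norm_tr; apply: le_trans;
    rewrite (bigD1 i)//= lerDl sumr_ge0.
apply: (subclosed_compact _ (@rV_compact R N (fun=> `[- r, r]%classic)
    (fun=> segment_compact (a := - r) (b := r)))) => [|u ur i /=]; last first.
  by rewrite in_itv/= -ler_norml coord_le.
rewrite (_ : l1_ball r =
    (fun u : 'rV[R]_N => \sum_i `|u ord0 i|) @^-1` [set x | x <= r]).
  apply: preimage_closed; last exact: closed_le.
  move=> u _; apply: continuous_sum => i {}u.
  apply: (@continuous_comp _ _ _ (fun u : 'rV[R]_N => u ord0 i) Num.norm).
    exact: coord_continuous.
  exact: norm_continuous.
by apply/seteqP; split=> u; rewrite /l1_ball/= l1norm_tr.
Qed.

Lemma l1_ball_segment (N : nat) (r t : R) (u u' : 'rV[R]_N) : 0 <= t <= 1 ->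
  l1_ball r u -> l1_ball r u' -> l1_ball r (u + t *: (u' - u)).
Proof.
rewrite /l1_ball/= !l1norm_tr => /andP[t0 t1] ur u'r.
apply: (@le_trans _ _
    ((1 - t) * (\sum_i `|u ord0 i|) + t * \sum_i `|u' ord0 i|)).
  rewrite !big_distrr -big_split; apply: ler_sum => i _ /=; rewrite !mxE.
  rewrite [X in `|X|](_ : _ = (1 - t) * u ord0 i + t * u' ord0 i); last by ring.
  rewrite (le_trans (ler_normD _ _))// !normrM (ger0_norm t0).
  by rewrite ger0_norm ?subr_ge0.
have : (1 - t) * (\sum_i `|u ord0 i|) <= (1 - t) * r.
  by rewrite ler_wpM2l ?subr_ge0.
have : t * (\sum_i `|u' ord0 i|) <= t * r by rewrite ler_wpM2l.
by lra.
Qed.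

Lemma l1_ball_axis (N : nat) (r e : R) i : `|e| <= r ->
  l1_ball r (e *: delta_mx ord0 i : 'rV[R]_N).
Proof.
rewrite /l1_ball/= l1norm_tr (bigD1 i)//= big1 => [|k /negPf ki].
  by rewrite !mxE !eqxx mulr1 addr0.
by rewrite !mxE ki mulr0 normr0.
Qed.

Lemma continuous_sqr_residual (m N : nat) (M : 'M[R]_(m, N)) (w : 'cV[R]_m) :
  continuous (fun u : 'rV[R]_N => dot (w - M *m u^T) (w - M *m u^T)).
Proof.
have coord_cont j : continuous (fun u : 'rV[R]_N => (w - M *m u^T) j ord0).
  rewrite (_ : (fun _ => _) =
      fun u : 'rV[R]_N => w j ord0 - \sum_i M j i * u ord0 i).
    move=> u; apply: (@continuousB R R _ (fun=> w j ord0)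
      (fun u : 'rV[R]_N => \sum_i M j i * u ord0 i)).
      exact: cst_continuous.
    apply: continuous_sum => i {}u.
    apply: (@continuousM R _ (fun=> M j i) (fun u : 'rV[R]_N => u ord0 i)).
      exact: cst_continuous.
    exact: coord_continuous.
  apply/funext => u; rewrite !mxE; congr (_ - _).
  by apply: eq_bigr => i _; rewrite mxE.
apply: continuous_sum => j u.
by apply: (@continuousM R _ (fun u => (w - M *m u^T) j ord0));
  exact: coord_cont.
Qed.

Lemma nearest_point_obtuse (m : nat) (y d : 'cV[R]_m) :
  (forall t, 0 <= t <= 1 -> dot y y <= dot (y - t *: d) (y - t *: d)) ->
  dot d y <= 0.
Proof.
move=> nearest; rewrite leNgt; apply/negP => dy0; have dd := dot_ge0 d.
have den : 0 < dot d y + dot d d by rewrite ltr_wpDr.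
pose t := dot d y / (dot d y + dot d d).
have tE : t * (dot d y + dot d d) = dot d y by rewrite divfK// gt_eqF.
have t0 : 0 < t by rewrite divr_gt0.
have t01 : 0 <= t <= 1 by rewrite ltW//= ler_pdivrMr// mul1r lerDl.
have := nearest t t01.
rewrite dotBl !dotBr !dotZl !dotZr (dotC y d).
by nra.
Qed.

(* [w - M u], for [u] minimizing its length over the [l1]-ball of radius [r], is
   normal to the image of that ball, hence contradicts the hypothesis unless it
   vanishes. *)
Lemma l1_solution_of_dual (m N : nat) (M : 'M[R]_(m, N)) (w : 'cV[R]_m)
    (r : R) :
  0 <= r -> (forall y, exists i, dot y w <= r * `|dot y (col i M)|) ->
  exists u : 'cV[R]_N, M *m u = w /\ l1norm u <= r.
Proof.
move=> r0 dual.
have ball0 : @l1_ball N r !=set0.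
  by exists 0; rewrite /l1_ball/= l1norm_tr big1// => i _; rewrite mxE normr0.
have [u] := compact_EVT_min ball0 (@compact_l1_ball N r)
  (continuous_subspaceT (@continuous_sqr_residual m N M w)).
rewrite inE => ur u_min; set y := w - M *m u^T.
have y_normal u' : l1_ball r u' -> dot (M *m u'^T) y <= dot (M *m u^T) y.
  move=> u'r; rewrite -subr_le0 -dotBl; apply: nearest_point_obtuse => t t01.
  have := u_min (u + t *: (u' - u)).
  rewrite inE => /(_ (l1_ball_segment t01 ur u'r)).
  suff -> : w - M *m (u + t *: (u' - u))^T = y - t *: (M *m u'^T - M *m u^T).
    by [].
  by rewrite linearD linearZ linearB/= mulmxDr -scalemxAr mulmxBr opprD addrA.
have [i yw] := dual y; pose e := r * Num.sg (dot y (col i M)).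
have er : `|e| <= r.
  by rewrite normrM ger0_norm// ler_piMr//; case: sgrP;
    rewrite ?normrN ?normr1 ?normr0.
have yu : r * `|dot y (col i M)| <= dot (M *m u^T) y.
  apply: le_trans (y_normal _ (l1_ball_axis i er)).
  rewrite linearZ/= -scalemxAr trmx_delta -colE dotZl (dotC (col i M)).
  by rewrite /e normrEsg mulrA.
have y0 : y = 0.
  apply: l2norm_eq0; apply/eqP.
  rewrite -sqrf_eq0 l2norm_sqr eq_le dot_ge0 andbT.
  have -> : dot y y = dot y w - dot y (M *m u^T) by rewrite -dotBr.
  by rewrite subr_le0 (le_trans yw)// (dotC y (M *m _)).
by exists u^T; split=> //; apply/esym/eqP; rewrite -subr_eq0 -/y y0.
Qed.

End l1_duality.

Section quantization.
Context {R : realType}.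
Variables (n : nat) (e : R).

Definition quant_level (x : R) : nat := minn n (Num.truncn (`|x| / e)).

Definition quant_index (x : R) : nat :=
  if 0 <= x then (n + quant_level x)%N else (n - quant_level x)%N.

Lemma quant_level_le x : (quant_level x <= n)%N. Proof. exact: geq_minl. Qed.

Lemma quant_index_lt x : (quant_index x < n + n.+1)%N.
Proof.
by rewrite /quant_index; have := quant_level_le x; case: ifP => _; lia.
Qed.

Definition quant (x : R) : 'I_(n + n.+1) := Ordinal (quant_index_lt x).

Definition quant_val (v : 'I_(n + n.+1)) : R := e * (v%:R - n%:R).

Lemma quantN x : quant (- x) = rev_ord (quant x).
Proof.
have level0 : quant_level 0 = 0%N.
  by rewrite /quant_level normr0 mul0r truncn0 minn0.
have levelN : quant_level (- x) = quant_level x by rewrite /quant_level normrN.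
apply: val_inj; rewrite /= /quant_index levelN oppr_ge0.
have := quant_level_le x.
by case: (ltgtP 0 x) => [_|_|<-]; rewrite ?level0; lia.
Qed.

Lemma quant_val_rev v : quant_val (rev_ord v) = - quant_val v.
Proof. by rewrite /quant_val /= natrB ?ltn_ord// natrD -!natr1; ring. Qed.

Lemma quant_valK x : quant_val (quant x) =
  (if 0 <= x then e * (quant_level x)%:R else - (e * (quant_level x)%:R)).
Proof.
by rewrite /quant_val /= /quant_index; case: ifP => _;
  rewrite ?natrD ?natrB ?quant_level_le//; ring.
Qed.

Hypothesis e_gt0 : 0 < e.

Let norm_div_ge0 (x : R) : 0 <= `|x| / e. Proof. by rewrite divr_ge0// ltW. Qed.

Lemma norm_quant_val x : `|quant_val (quant x)| = e * (quant_level x)%:R.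
Proof.
by rewrite quant_valK; case: ifP => _;
  rewrite ?normrN ger0_norm// mulr_ge0// ltW.
Qed.

Lemma quant_level_itv x : `|x| <= n%:R * e ->
  e * (quant_level x)%:R <= `|x| <= e * (quant_level x)%:R + e.
Proof.
move=> xn; have trunc_le : (Num.truncn (`|x| / e) <= n)%N.
  by rewrite -(ler_nat R) (@le_trans _ _ (`|x| / e))// ?truncn_le// ler_pdivrMr.
rewrite /quant_level (minn_idPr trunc_le).
have /andP[] := truncn_itv (norm_div_ge0 x).
rewrite ler_pdivlMr// ltr_pdivrMr// -natr1 => lo up.
by apply/andP; split; lra.
Qed.

Lemma norm_quant_val_le x : `|quant_val (quant x)| <= `|x|.
Proof.
rewrite norm_quant_val.
have [/quant_level_itv/andP[]//|/ltW xn] := leP `|x| (n%:R * e).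
by apply: le_trans xn; rewrite mulrC ler_pM2r// ler_nat quant_level_le.
Qed.

Lemma quant_error x : `|x| <= n%:R * e -> `|x - quant_val (quant x)| <= e.
Proof.
move=> /quant_level_itv/andP[]; rewrite quant_valK; case: (leP 0 x) => x0.
  by rewrite ger0_norm// => lo up; rewrite ler_norml; lra.
by rewrite ltr0_norm// => lo up; rewrite ler_norml; lra.
Qed.

Lemma norm_quant_val_ge (t x : R) : t <= n%:R * e -> t + e < `|x| ->
  t <= `|quant_val (quant x)|.
Proof.
move=> tn tx; rewrite norm_quant_val.
have [/quant_level_itv/andP[]|xn] := leP `|x| (n%:R * e); first by lra.
rewrite /quant_level (minn_idPl _); first by rewrite mulrC.
by rewrite truncn_ge_nat// ler_pdivlMr// ltW.
Qed.

Lemma quant_index_homo : {homo quant_index : x y / x <= y >-> (x <= y)%N}.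
Proof.
have level_homo (x y : R) : `|x| <= `|y| -> (quant_level x <= quant_level y)%N.
  move=> xy; rewrite leq_min geq_minl /=; apply: leq_trans (geq_minr _ _) _.
  by apply: le_truncn; rewrite ler_pM2r// invr_gt0.
move=> x y xy; rewrite /quant_index.
case: (leP 0 x) => x0; case: (leP 0 y) => y0.
- by rewrite leq_add2l level_homo// !ger0_norm.
- by have := lt_le_trans y0 (le_trans x0 xy); rewrite ltxx.
- by lia.
- by rewrite leq_sub2l// level_homo// !ltr0_norm// lerN2.
Qed.

Lemma measurable_quant v : measurable (quant @^-1` [set v]).
Proof.
apply: is_interval_measurable => x y.
move=> /(congr1 val)/= qx /(congr1 val)/= qy z /andP[xz zy].
by apply/val_inj/eqP; rewrite eqn_leq /= -{1}qy -qx !quant_index_homo.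
Qed.

End quantization.

Section law_of_finite_valued_variable.
Context {R : realType} {d : measure_display} {T : measurableType d}.
Variables (P : probability T R) (V : finType) (Y : T -> V).
Hypothesis mY : forall v, measurable (Y @^-1` [set v]).

Definition law (v : V) : R := fine (P (Y @^-1` [set v])).

Lemma lawE v : P (Y @^-1` [set v]) = (law v)%:E.
Proof. by rewrite fineK// fin_num_measure. Qed.

Lemma sum_indic_preimage (g : V -> R) w :
  g (Y w) = \sum_v g v * \1_(Y @^-1` [set v]) w.
Proof.
rewrite (bigD1 (Y w))//= indicE mem_set// mulr1 big1 ?addr0// => v vY.
by rewrite indicE memNset ?mulr0// => /= Yv; rewrite Yv eqxx in vY.
Qed.

Lemma measurable_finite_valued (g : V -> R) : measurable_fun setT (g \o Y).
Proof.
rewrite (_ : g \o Y = fun w => \sum_v g v * \1_(Y @^-1` [set v]) w).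
  by apply: measurable_sum => v; exact: measurable_funM.
by apply/funext => w; exact: sum_indic_preimage.
Qed.

Lemma integral_finite_valued (g : V -> R) : (forall v, 0 <= g v) ->
  (\int[P]_w (g (Y w))%:E = (mean law g)%:E)%E.
Proof.
move=> g0; under eq_integral do rewrite sum_indic_preimage -sumEFin.
rewrite ge0_integral_sum// => [|v|v w _]; last by rewrite lee_fin mulr_ge0.
  rewrite /mean -sumEFin; apply: eq_bigr => v _.
  under eq_integral do rewrite EFinM.
  rewrite ge0_integralZl_EFin//; last exact/measurable_EFinP.
  by rewrite integral_indic// setIT mulrC EFinM -lawE.
by apply/measurable_EFinP; exact: measurable_funM.
Qed.

Lemma measurable_finite_event (S : pred V) : measurable [set w | S (Y w)].
Proof.
have := measurable_finite_valued (fun v => (S v)%:R) measurableT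
  (measurable_itv `[1, +oo[).
rewrite setTI; congr measurable; apply/seteqP; split=> w /=;
  rewrite in_itv/= andbT.
  by case: (S _); rewrite ?ler10.
by move=> ->.
Qed.

Lemma prob_finite_event (S : pred V) : P [set w | S (Y w)] = (prob law S)%:E.
Proof.
rewrite -integral_finite_valued//.
have -> : (fun w => (S (Y w))%:R%:E) = (fun w => (\1_[set w | S (Y w)] w)%:E).
  move=> k; apply/funext => w; rewrite indicE; congr (_%:R%:E).
  by rewrite mem_setE.
by rewrite integral_indic ?setIT//; exact: measurable_finite_event.
Qed.

Lemma law_pmf : is_pmf law.
Proof.
split=> [v|]; first exact: fine_ge0.
transitivity (mean law (fun=> 1)).
  by apply: eq_bigr => v _; rewrite mulr1.
apply: EFin_inj; rewrite -integral_finite_valued//.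
by rewrite integral_cst//= mul1e probability_setT.
Qed.

Lemma mean_law_le_integral (g : V -> R) (f : T -> R) : (forall v, 0 <= g v) ->
  measurable_fun setT f -> (forall w, g (Y w) <= f w) ->
  ((mean law g)%:E <= \int[P]_w (f w)%:E)%E.
Proof.
move=> g0 mf gf; rewrite -integral_finite_valued//.
apply: ge0_le_integral => //.
- by move=> w _; rewrite lee_fin.
- by apply/measurable_EFinP; exact: measurable_finite_valued.
- exact/measurable_EFinP.
- by move=> w _; rewrite lee_fin.
Qed.

End law_of_finite_valued_variable.

Lemma measurable_norm_gt {R : realType} {d : measure_display}
    {T : measurableType d} (f : T -> R) (t : R) :
  measurable_fun setT f -> measurable [set w | (t < `|f w|)%R].
Proof.
move=> mf.
have mnf : measurable_fun setT (fun w => `|f w|) by exact: measurableT_comp.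
have := measurable_fun_ltr (measurable_cst t) mnf measurableT (Y := [set true]).
by rewrite setTI; apply.
Qed.

Lemma sqr_le_truncation {R : realType} (A x : R) : 0 < A ->
  x ^+ 2 <= 1 / 4 + (A * (1 / 2 < `|x|)%R%:R + A^-1 * x ^+ 4).
Proof.
move=> A0; have x40 : 0 <= A^-1 * x ^+ 4.
  by rewrite mulr_ge0 ?invr_ge0 ?exprn_even_ge0// ltW.
have [AX|XA] := leP A (x ^+ 2).
  have : x ^+ 2 <= A^-1 * x ^+ 4.
    by rewrite mulrC ler_pdivlMr// (exprD x 2 2) ler_wpM2l ?sqr_ge0.
  have : 0 <= A * (1 / 2 < `|x|)%R%:R by rewrite mulr_ge0// ltW.
  by lra.
case: (ltP (1 / 2)) => [_|x_small]; first by rewrite mulr1; lra.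
have : `|x| ^+ 2 <= (1 / 2) ^+ 2 by rewrite lerXn2r ?nnegrE//; lra.
by rewrite real_normK ?num_real// mulr0; lra.
Qed.

Section moment_tails.
Context {R : realType} {d : measure_display} {T : measurableType d}.
Variables (P : probability T R) (X : {RV P >-> R}).
Hypothesis X2 : ('E_P[fun w => (X w ^+ 2)%R] = 1)%E.

Lemma integral_sqr_eq1 : (\int[P]_w (X w ^+ 2)%:E = 1)%E.
Proof. by rewrite -X2 unlock. Qed.

Lemma second_moment_tail (t : R) : 0 < t ->
  (P [set w | (t < `|X w|)%R] <= (t ^- 2)%:E)%E.
Proof.
move=> t0; have t20 : 0 < t ^+ 2 by rewrite exprn_gt0.
have sqr_homo : {in Num.nneg &, {homo (fun x : R => x ^+ 2) : x y / x <= y}}.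
  by move=> x y x0 y0 xy; rewrite lerXn2r.
have := markov X t0 (exprn_measurable 2) (fun r _ => sqr_ge0 r) sqr_homo.
have -> : (fun x : R => x ^+ 2) \o (fun x => `|x|) \o X = fun w => X w ^+ 2.
  by apply/funext => w /=; rewrite real_normK ?num_real.
rewrite X2 -lee_pdivlMl// mule1; apply: le_trans.
apply: le_measure; rewrite ?inE.
- exact: measurable_norm_gt.
- under eq_set do rewrite lee_fin; rewrite -[X in measurable X]setTI.
  by apply: measurable_fun_le => //; exact: measurableT_comp.
- by move=> w /= /ltW.
Qed.

Lemma integral_pow4_le (K : R) : (Lnorm P 4%:E (EFin \o X) <= K%:E)%E ->
  (\int[P]_w (X w ^+ 4)%:E <= (K ^+ 4)%:E)%E.
Proof.
move=> XK.
have -> : (\int[P]_w (X w ^+ 4)%:E = Lnorm P 4%:E (EFin \o X) `^ 4)%E.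
  rewrite poweR_Lnorm//; apply: eq_integral => w _ /=.
  by rewrite (powR_mulrn 4)// -normrX ger0_norm// exprn_even_ge0.
have : (Lnorm P 4%:E (EFin \o X) \is a fin_num)%E.
  by rewrite ge0_fin_numE ?Lnorm_ge0// (le_lt_trans XK) ?ltry.
move: XK; have := Lnorm_ge0 P 4%:E (EFin \o X).
case: (Lnorm _ _ _) => //= r; rewrite !lee_fin => r0 rK _.
by rewrite (powR_mulrn 4)// lerXn2r ?nnegrE// (le_trans r0).
Qed.

Lemma fourth_moment_anticoncentration (L : R) : 0 <= L ->
  (\int[P]_w (X w ^+ 4)%:E <= L%:E)%E ->
  ((2 * (4 * L + 1))^-1%:E <= P [set w | (1 / 2 < `|X w|)%R])%E.
Proof.
move=> L0 X4; pose A := 4 * L + 1; pose E := [set w | (1 / 2 < `|X w|)%R].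
have A0 : 0 < A by rewrite /A; lra.
have mE : measurable E by exact: measurable_norm_gt.
have mX k : measurable_fun setT (fun w => (X w ^+ k)%:E).
  by apply/measurable_EFinP; exact: measurable_funX.
have mI : measurable_fun setT (fun w => (\1_E w)%:E : \bar R).
  by apply/measurable_EFinP; exact: measurable_indic.
have X4_ge0 w : (0 <= (X w ^+ 4)%:E)%E by rewrite lee_fin exprn_even_ge0.
have integral_bound :
    (\int[P]_w ((1 / 4)%:E + (A%:E * (\1_E w)%:E + A^-1%:E * (X w ^+ 4)%:E))
      = (1 / 4)%:E + (A%:E * P E + A^-1%:E * \int[P]_w (X w ^+ 4)%:E))%E.
  rewrite ge0_integralD//; first last.
  - by apply: emeasurable_funD; exact: measurable_funeM.
  - by move=> w _; rewrite adde_ge0// mule_ge0// lee_fin ?invr_ge0 ltW.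
  rewrite integral_cst//= probability_setT mule1; congr (_ + _)%E.
  rewrite ge0_integralD//; first last.
  - exact: measurable_funeM.
  - by move=> w _; rewrite mule_ge0// lee_fin invr_ge0 ltW.
  - exact: measurable_funeM.
  - by move=> w _; rewrite mule_ge0// lee_fin ltW.
  rewrite !ge0_integralZl_EFin ?invr_ge0 ?(ltW A0)//.
  by rewrite integral_indic// setIT.
have : (1 <= (1 / 4)%:E + (A%:E * P E + A^-1%:E * L%:E))%E.
  apply: (@le_trans _ _
    ((1 / 4)%:E + (A%:E * P E + A^-1%:E * \int[P]_w (X w ^+ 4)%:E))%E).
    rewrite -integral_bound -integral_sqr_eq1; apply: ge0_le_integral => //.
    - by move=> w _; rewrite lee_fin sqr_ge0.
    - apply: emeasurable_funD => //.
      by apply: emeasurable_funD; exact: measurable_funeM.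
    move=> w _; rewrite -!EFinM -!EFinD lee_fin indicE mem_setE/=.
    exact: sqr_le_truncation.
  by rewrite leeD2l// leeD2l// lee_pmul2l// lte_fin invr_gt0.
have PEf : P E \is a fin_num by rewrite fin_num_measure.
rewrite -(fineK PEf) -!EFinM -!EFinD !lee_fin => bound.
have AL : A^-1 * L <= 1 / 4 by rewrite mulrC ler_pdivrMr// /A; lra.
by rewrite -[leLHS]mul1r ler_pdivrMr ?mulr_gt0// -/A; lra.
Qed.

End moment_tails.

Lemma normal_pdf_ge {R : realType} (u x : R) : 0 <= u -> u < x <= u + 1 ->
  normal_peak 1 * expR (- (1 + u ^+ 2)) <= normal_pdf 0 1 x.
Proof.
move=> u0 /andP[ux xu].
rewrite normal_pdfE ?oner_eq0// ler_wpM2l ?normal_peak_ge0//.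
rewrite ler_expR subr0 expr1n mulNr lerN2.
have : 0 <= (u + 1 - x) * (u + 1 + x) by rewrite mulr_ge0//; lra.
by have := sqr_ge0 (u - 1); lra.
Qed.

Definition gauss_tail {R : realType} (k sigma t : R) : R :=
  k * expR (- (1 + (t / sigma) ^+ 2)).

Lemma normal_tail_ge {R : realType} (sigma t : R) : 0 < sigma -> 0 < t ->
  ((gauss_tail (normal_peak 1) sigma t)%:E <=
    normal_prob 0 1 [set x : R | (t < `|sigma * x|)%R])%E.
Proof.
move=> s0 t0; rewrite /gauss_tail; set u := t / sigma.
have u0 : 0 < u by rewrite divr_gt0.
pose I : set R := `]u, (u + 1)]%classic.
have mI : measurable I by exact: measurable_itv.
have mpdf (D : set R) :
    measurable_fun D (fun x => (normal_pdf 0 1 x)%:E : \bar R).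
  by apply/measurable_EFinP; apply: measurable_funTS;
    exact: measurable_normal_pdf.
have I1 : lebesgue_measure I = 1%E.
  by rewrite /I lebesgue_measure_itv/= lte_fin ltrDl ltr01 -EFinD addrC addKr.
apply: (@le_trans _ _
  (\int[lebesgue_measure]_(x in I) (normal_pdf 0 1 x)%:E)%E).
  rewrite -[leLHS]mule1 -[X in (_ * X)%E]I1 -integral_cst//.
  apply: ge0_le_integral => //.
  - by move=> x _; rewrite lee_fin mulr_ge0 ?normal_peak_ge0 ?expR_ge0.
  - exact: mpdf.
  - move=> x; rewrite /I/= in_itv/= => xI.
    by rewrite lee_fin normal_pdf_ge// ltW.
apply: ge0_subset_integral => //.
- apply: (@measurable_norm_gt R _ R (fun x : R => sigma * x)).
  exact: measurable_funM.
- exact: mpdf.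
- by move=> x _; rewrite lee_fin normal_pdf_ge0.
- move=> x; rewrite /I /= in_itv/= => /andP[ux _].
  by rewrite normrM gtr0_norm// gtr0_norm ?(lt_trans u0)// mulrC -ltr_pdivrMr.
Qed.

Section discretized_law.
Context {R : realType} {d : measure_display} {T : measurableType d}.
Variables (P : probability T R) (X : {RV P >-> R}).
Hypothesis X2 : ('E_P[fun w => (X w ^+ 2)%R] = 1)%E.
Hypothesis X_sym : symmetric_rv P X.

Definition disc_law (n : nat) (e : R) := law P (quant n e \o X).

Arguments disc_law n e v : clear implicits.

Lemma measurable_quant_rv n e : 0 < e ->
  forall v, measurable ((quant n e \o X) @^-1` [set v]).
Proof.
by move=> e0 v; rewrite comp_preimage;
  exact: measurable_funPTI (measurable_quant e0 v).
Qed.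

Lemma disc_law_pmf n e : 0 < e -> is_pmf (disc_law n e).
Proof. by move=> e0; apply: law_pmf; exact: measurable_quant_rv. Qed.

Lemma disc_law_second_moment n e : 0 < e ->
  mean (disc_law n e) (fun v => quant_val e v ^+ 2) <= 1.
Proof.
move=> e0; rewrite -lee_fin -(integral_sqr_eq1 X2).
apply: mean_law_le_integral; first exact: measurable_quant_rv.
- by move=> v; exact: sqr_ge0.
- exact: measurable_funX.
- move=> w; rewrite -[leLHS]real_normK ?num_real//.
  rewrite -[leRHS]real_normK ?num_real//.
  by rewrite lerXn2r ?nnegrE// norm_quant_val_le.
Qed.

Lemma disc_law_rev n e v : 0 < e -> disc_law n e (rev_ord v) = disc_law n e v.
Proof.
move=> e0; rewrite /disc_law /law; congr fine.
transitivity (P ((fun w => - X w) @^-1` (quant n e @^-1` [set rev_ord v]))).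
  exact: X_sym (measurable_quant e0 (rev_ord v)).
congr (P _); apply/seteqP; split=> w /=; rewrite quantN; last by move=> ->.
exact: rev_ord_inj.
Qed.

Lemma disc_law_tail n e (t u p : R) : 0 < e -> t <= n%:R * e -> t + e <= u ->
  (p%:E <= P [set w | (u < `|X w|)%R])%E ->
  p <= prob (disc_law n e) (fun v => t <= `|quant_val e v|).
Proof.
move=> e0 tn tu pu; rewrite -lee_fin (le_trans pu)//.
have mquant := @measurable_quant_rv n e e0.
rewrite -(prob_finite_event P mquant (fun v => t <= `|quant_val e v|)%R).
apply: le_measure; rewrite ?inE; first exact: measurable_norm_gt.
  exact: (measurable_finite_event mquant (fun v => t <= `|quant_val e v|)%R).
by move=> w /= uw; apply: norm_quant_val_ge => //; exact: le_lt_trans uw.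
Qed.

Lemma tiltable_disc_small n e (p C c B z : R) :
  0 < e <= 1 / 4 -> 1 / 4 <= n%:R * e ->
  (p%:E <= P [set w | (1 / 2 < `|X w|)%R])%E ->
  1 <= C -> 0 <= c <= p / 4 -> 2 <= B ->
  `|z| <= 1 -> tiltable (disc_law n e) (quant_val e) C c B z.
Proof.
move=> /andP[e0 e1] ne pX C1 /andP[c0 cp] B2 z1.
have q_pmf := disc_law_pmf n e0.
apply: (tiltable_small q_pmf (disc_law_second_moment n e0) (@rev_ordK _)
  (fun v => disc_law_rev v e0) (@quant_val_rev _ _ _)) => //.
have tail : p <= prob (disc_law n e) (fun v => 1 / 4 <= `|quant_val e v|).
  by apply: disc_law_tail pX => //; lra.
have quarter0 : 0 < 1 / 4 :> R by lra.
have := prob_markov q_pmf.1 quarter0 (fun v => normr_ge0 (quant_val e v)).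
by rewrite ler_pdivlMr//; move: cp tail; lra.
Qed.

Variables k sigma : R.
Hypotheses (k_gt0 : 0 < k) (sigma_gt0 : 0 < sigma).
Hypothesis X_tail : forall t, 0 < t ->
  ((gauss_tail k sigma t)%:E <= P [set w | (t < `|X w|)%R])%E.

Definition gauss_tilt_rate : R := 2 + 4 / sigma ^+ 2 + 2 / k.

Lemma gauss_tilt_rate_ge1 : 1 <= gauss_tilt_rate.
Proof.
have : 0 <= 4 / sigma ^+ 2 by rewrite divr_ge0 ?sqr_ge0.
have : 0 < 2 / k by rewrite divr_gt0.
by rewrite /gauss_tilt_rate; lra.
Qed.

Lemma gauss_tail_double_ge (z : R) : 1 <= `|z| ->
  2 * expR (- (gauss_tilt_rate * z ^+ 2)) <= gauss_tail k sigma (2 * `|z|).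
Proof.
move=> z1.
have z21 : 1 <= z ^+ 2 by rewrite -[leRHS]real_normK ?num_real// exprn_ege1.
rewrite /gauss_tail /gauss_tilt_rate; set r := 4 / sigma ^+ 2.
have -> : (2 * `|z| / sigma) ^+ 2 = r * z ^+ 2.
  by rewrite -[in RHS](real_normK (num_real z)) /r; field; rewrite gt_eqF.
have r0 : 0 <= r by rewrite divr_ge0 ?sqr_ge0.
have k20 : 0 < 2 / k by rewrite divr_gt0.
have exp_k : 2 * expR (- (2 / k)) <= k.
  rewrite expRN ler_pdivrMr ?expR_gt0// mulrC -ler_pdivrMr//.
  by have := expR_ge1Dx (2 / k); lra.
apply: le_trans (ler_wpM2r (expR_ge0 _) exp_k).
rewrite -mulrA ler_pM2l// -expRD ler_expR.
by move: z21 k20; move: (2 / k) => k2; nra.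
Qed.

Lemma tiltable_disc_large n e (c B z : R) : 0 < e <= 1 / 4 ->
  `|z| <= n%:R * e ->
  0 < c <= 1 -> 1 <= `|z| -> expR (gauss_tilt_rate * z ^+ 2) <= B ->
  tiltable (disc_law n e) (quant_val e) gauss_tilt_rate c B z.
Proof.
move=> /andP[e0 e1] zn c01 z1 eB; have z0 : 0 < `|z| by lra.
apply: (tiltable_large (disc_law_pmf n e0) (disc_law_second_moment n e0)
  (@rev_ordK _) (fun v => disc_law_rev v e0) (@quant_val_rev _ _ _)) => //.
- by rewrite (le_trans ler01)// gauss_tilt_rate_ge1.
- by rewrite -normr_gt0.
apply: (le_trans (gauss_tail_double_ge z1)).
apply: (disc_law_tail e0 zn _ (X_tail _)); first by lra.
by rewrite mulr_gt0.
Qed.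

End discretized_law.

Arguments disc_law {R d T P} X n e v.

(* The mesh is at most [1 / 4] so that [1 / 2 < |X|] forces
   [1 / 4 <= |quant_val|], and the range resolves [|X|] up to [b]. *)
Definition disc_tiltable {R : realType} {d : measure_display}
    {T : measurableType d} {P : probability T R} (X : {RV P >-> R})
    (C c B b : R) : Prop :=
  forall n e, 0 < e <= 1 / 4 -> b + 1 / 4 <= n%:R * e ->
  forall z, `|z| <= b -> tiltable (disc_law X n e) (quant_val e) C c B z.

Lemma measure_bigsetU_le (R : realType) (d : measure_display)
    (T : measurableType d) (mu : {measure set T -> \bar R}) (K : finType)
    (E : K -> set T) :
  (forall k, measurable (E k)) ->
  (mu (\big[setU/set0]_k E k) <= \sum_k mu (E k))%E.
Proof.
move=> mE; elim: (index_enum K) => [|k s IH];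
  first by rewrite !big_nil measure0.
rewrite !big_cons; apply: (le_trans (measureU2 _ _ _)) => //.
  exact: bigsetU_measurable.
exact: leeD.
Qed.

Lemma with_prob_at_leastCU (R : realType) (d : measure_display)
    (T : measurableType d) (P : probability T R) (A B E : set T) (p : R) :
  measurable A -> measurable B -> (P A <= p%:E)%E -> (P B <= p%:E)%E ->
  ~` (A `|` B) `<=` E -> with_prob_at_least P E (1 - 2 * p).
Proof.
move=> mA mB PA PB ABE; have mAB := measurableU _ _ mA mB.
exists (~` (A `|` B)); split=> //; first exact: measurableC.
rewrite probability_setC// EFinB leeB// (le_trans (measureU2 _ mA mB))//.
by rewrite mulr_natl mulr2n EFinD leeD.
Qed.

Section random_matrix.
Context {R : realType} {m N : nat} {d d' : measure_display}.
Context {T : measurableType d} {T' : measurableType d'}.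
Variables (P : probability T R) (a : 'I_m -> 'I_N -> {RV P >-> R}).
Variables (P' : probability T' R) (X : {RV P' >-> R}).
Hypothesis model : random_matrix_model a X.

Definition sample_matrix (w : T) : 'M[R]_(m, N) := \matrix_(j, i) a j i w.

Definition map_entries (V : finType) (phi : R -> V) (w : T) :
  {ffun 'I_N -> {ffun 'I_m -> V}} := [ffun i => [ffun j => phi (a j i w)]].

Lemma model_sqr_moment : ('E_P'[fun w => (X w ^+ 2)%R] = 1)%E.
Proof. by case: model => _ _ _ []. Qed.

Lemma model_symmetric : (0 < m)%N -> (0 < N)%N -> symmetric_rv P' X.
Proof.
move=> m0 N0; have [_ sym same _] := model => B mB.
pose i := Ordinal N0; pose j := Ordinal m0.
rewrite -(same j i _ mB) (sym j i _ mB); apply: (same j i [set x | B (- x)]).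
by have := @oppr_measurable R setT measurableT _ mB; rewrite setTI.
Qed.

Section finite_valued_entries.
Variables (V : finType) (phi : R -> V).
Hypothesis mphi : forall v, measurable (phi @^-1` [set v]).

Let preimage_entries v : map_entries phi @^-1` [set v] =
  \bigcap_(ji in [set ji | ji \in [set: 'I_m * 'I_N]%SET])
    (a ji.1 ji.2 @^-1` (phi @^-1` [set v ji.2 ji.1])).
Proof.
apply/seteqP; split=> [w /= <- [j i] _|w w_v]; first by rewrite /= !ffunE.
apply/ffunP => i; apply/ffunP => j; rewrite !ffunE.
by apply: (w_v (j, i)); rewrite /= finset.in_setT.
Qed.

Lemma measurable_map_entries v : measurable (map_entries phi @^-1` [set v]).
Proof.
rewrite preimage_entries; apply: fin_bigcap_measurable => [|ji _].
  exact: finite_finset.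
exact: measurable_funPTI (mphi _).
Qed.

Lemma law_map_entries :
  law P (map_entries phi) = prodw (fun=> prodw (fun=> law P' (phi \o X))).
Proof.
apply/funext => v; apply: EFin_inj; rewrite -(lawE P measurable_map_entries).
have [indep _ same _] := model.
rewrite preimage_entries.
have -> := indep _ (fun ji => phi @^-1` [set v ji.2 ji.1]); last first.
  by move=> ji; exact: mphi.
rewrite /prodw exchange_big/= pair_big/= -prodEFin.
apply: eq_big => [ji|[j i] _]; first by rewrite finset.in_setT.
rewrite (same j i _ (mphi _)) /law fineK// fin_num_measure//.
by rewrite comp_preimage; exact: measurable_funPTI (mphi _).
Qed.

End finite_valued_entries.

Definition entry_exceeds (L : R) : set T :=
  \big[setU/set0]_(ji : 'I_m * 'I_N) [set w | (L < `|a ji.1 ji.2 w|)%R].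

Lemma measurable_entry_exceeds L : measurable (entry_exceeds L).
Proof. by apply: bigsetU_measurable => ji _; exact: measurable_norm_gt. Qed.

Lemma prob_entry_exceeds L : 0 < L ->
  (P (entry_exceeds L) <= ((m * N)%:R / L ^+ 2)%:E)%E.
Proof.
move=> L0; have [_ _ same _] := model.
have mL (f : R -> R) : measurable_fun setT f ->
    measurable [set x | (L < `|f x|)%R].
  exact: measurable_norm_gt.
rewrite (le_trans (measure_bigsetU_le P _))// => [ji|].
  exact: measurable_norm_gt.
apply: (@le_trans _ _ (\sum_(ji : 'I_m * 'I_N) (L ^- 2)%:E)%E).
  apply: lee_sum => -[j i] _ /=.
  have -> : P [set w | (L < `|a j i w|)%R] = P' [set w | (L < `|X w|)%R].
    exact: (same j i _ (mL idfun (@measurable_id _ _ _))).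
  exact: (second_moment_tail model_sqr_moment L0).
by rewrite sumEFin lee_fin sumr_const card_prod !card_ord mulr_natl.
Qed.

Lemma quantized_column_close n e w i : 0 < e -> ~ entry_exceeds (n%:R * e) w ->
  l2norm (column (quant_val e) (map_entries (quant n e) w i)
          - col i (sample_matrix w))
    <= e * Num.sqrt m%:R.
Proof.
move=> e0 bounded; apply: l2norm_le_coord => [|j]; first exact: ltW.
rewrite !mxE !ffunE distrC quant_error// leNgt.
apply/negP => large; apply: bounded.
by rewrite /entry_exceeds -bigcup_seq; exists (j, i) => //=;
  rewrite mem_index_enum.
Qed.

End random_matrix.

Definition clip_ball {R : realType} {m : nat} (N : nat) (nrm : 'cV[R]_m -> R) :
  set 'cV[R]_m := [set z | nrm z <= clip_level m N].

Section quotient_property.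
Context {R : realType} {m N : nat}.
Variable nrm : 'cV[R]_m -> R.
Hypothesis mN : (0 < m <= N)%N.
Hypothesis nrmZ : forall k w, 0 < k -> nrm (k *: w) = k * nrm w.
Hypothesis nrm_ge : forall w, l2norm w <= nrm w.
Hypothesis nrm_le : forall w, nrm w <= clip_level m N * l2norm w.

Lemma unit_ball_clip_ball z : l2norm z <= 1 -> clip_ball N nrm z.
Proof.
by move=> z1; rewrite /clip_ball/= (le_trans (nrm_le z))// ler_piMr ?sqrtr_ge0.
Qed.

Lemma clip_ball_bounded z : clip_ball N nrm z -> l2norm z <= clip_level m N.
Proof. exact: le_trans. Qed.

Lemma dot_le_support_fun_clip_ball y w :
  clip_level m N * dot y w <= nrm w * support_fun (clip_ball N nrm) y.
Proof.
have [w0|w0] := eqVneq w 0.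
  have : nrm w = 0.
    apply/eqP; rewrite eq_le (le_trans _ (nrm_ge w)) ?l2norm_ge0// andbT.
    by rewrite (le_trans (nrm_le w))// w0 l2norm0 mulr0.
  by move=> ->; rewrite w0 dotC dot0l mulr0 mul0r.
have nw0 : 0 < nrm w by rewrite (lt_le_trans _ (nrm_ge w))// l2norm_gt0.
have al0 : 0 < clip_level m N :> R := clip_level_gt0 mN.
rewrite -ler_pdivrMl// mulrA -dotZr.
apply: (dot_le_support_fun unit_ball_clip_ball clip_ball_bounded).
by rewrite /clip_ball/= nrmZ ?mulr_gt0 ?invr_gt0// mulrAC mulVf ?mul1r// gt_eqF.
Qed.

Lemma sqrt_s_star : Num.sqrt (s_star m N) = Num.sqrt m%:R / clip_level m N :> R.
Proof.
have : 0 < clip_level m N :> R := clip_level_gt0 mN.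
rewrite sqrtr_gt0 => /ltW ln_ge0.
by rewrite /s_star sqrtrM// sqrtrV.
Qed.

Lemma l1_quotient_of_norming (D : R) (A : 'M[R]_(m, N)) : 0 <= D ->
  norming D (support_fun (clip_ball N nrm)) (fun i => col i A) ->
  l1_quotient_property ((Num.sqrt m%:R)^-1 *: A) D nrm.
Proof.
move=> D0 Anorming w.
have nw0 : 0 <= nrm w by rewrite (le_trans _ (nrm_ge w)) ?l2norm_ge0.
have sqrtm0 : 0 < Num.sqrt m%:R :> R by rewrite sqrtr_gt0 ltr0n; case/andP: mN.
have al0 : 0 < clip_level m N :> R := clip_level_gt0 mN.
apply: l1_solution_of_dual => [|y]; first by rewrite !mulr_ge0 ?sqrtr_ge0.
have [i yi] := Anorming y; exists i.
rewrite linearZ dotZr normrM gtr0_norm ?invr_gt0// -(ler_pM2l al0).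
rewrite (le_trans (dot_le_support_fun_clip_ball y w))//.
rewrite (le_trans (ler_wpM2l nw0 yi))//.
by rewrite sqrt_s_star le_eqVlt; apply/orP; left; apply/eqP; field;
  rewrite !gt_eqF.
Qed.

End quotient_property.

Section high_probability.
Context {R : realType}.

Definition quotient_property_whp {m N : nat} {d : measure_display}
    {T : measurableType d} {P : probability T R}
    (a : 'I_m -> 'I_N -> {RV P >-> R}) (D : R) (nrm : 'cV[R]_m -> R) : Prop :=
  with_prob_at_least P
    [set w | l1_quotient_property (scaled_matrix (fun j i => a j i : T -> R) w)
               D nrm]
    (1 - 2 * expR (- (2 * m%:R))).

Lemma exists_discretization (m N : nat) (D b : R) :
  (0 < m)%N -> (0 < N)%N -> 0 < D ->
  exists (n : nat) (e : R),
    [/\ 0 < e <= 1 / 4, b + 1 / 4 <= n%:R * e, D * (e * Num.sqrt m%:R) <= 1 / 2,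
        0 < n%:R * e & (m * N)%:R / (n%:R * e) ^+ 2 <= expR (- (2 * m%:R))].
Proof.
move=> m0 N0 D0.
have sqrtm0 : 0 < Num.sqrt m%:R :> R by rewrite sqrtr_gt0 ltr0n.
have den0 : 0 < 2 * (D * Num.sqrt m%:R) by rewrite mulr_gt0// mulr_gt0.
pose e := Num.min (1 / 4) (1 / (2 * (D * Num.sqrt m%:R))).
have e0 : 0 < e by rewrite lt_min !divr_gt0.
pose L := (m * N)%:R * expR (2 * m%:R) : R.
have mN1 : 1 <= (m * N)%:R :> R by rewrite ler1n muln_gt0 m0.
have L1 : 1 <= L.
  by rewrite -[leLHS]mulr1 ler_pM// -expR0 ler_expR mulr_ge0.
pose n := (Num.truncn (Num.max (b + 1 / 4) L / e)).+1.
have : Num.max (b + 1 / 4) L <= n%:R * e.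
  by rewrite -ler_pdivrMr// ltW// truncnS_gt.
rewrite ge_max => /andP[bn Ln]; have ne0 : 0 < n%:R * e by lra.
exists n, e; split=> //.
- by rewrite e0 ge_min lexx.
- have : e <= 1 / (2 * (D * Num.sqrt m%:R)) by rewrite ge_min lexx orbT.
  by rewrite ler_pdivlMr//; lra.
rewrite ler_pdivrMr ?exprn_gt0// expRN mulrC ler_pdivlMr ?expR_gt0// -/L.
by rewrite (le_trans Ln)// expr2 ler_peMr ?(ltW ne0)//; lra.
Qed.

Lemma l1_quotient_whp (C c : R) : 1 <= C -> 0 < c <= 1 ->
  exists Ct : R, 1 <= Ct /\
  forall (m N : nat) (d : measure_display) (T : measurableType d)
    (P : probability T R) (a : 'I_m -> 'I_N -> {RV P >-> R})
    (d' : measure_display) (T' : measurableType d')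
    (P' : probability T' R) (X : {RV P' >-> R}) (nrm : 'cV[R]_m -> R) (b : R),
  (0 < m)%N -> random_matrix_model a X -> Ct * m%:R <= N%:R ->
  (forall k w, 0 < k -> nrm (k *: w) = k * nrm w) ->
  (forall w, l2norm w <= nrm w <= clip_level m N * l2norm w) ->
  (forall z, nrm z <= clip_level m N -> forall j, `|z j ord0| <= b) ->
  disc_tiltable X C c (tilt_bound C (clip_level m N)) (tilt_scale C * b) ->
  quotient_property_whp a (24 / (c * tilt_scale C)) nrm.
Proof.
move=> C1 c01; have [Ct norming_whp] := iid_matrix_norming C1 c01.
exists (Num.max 1 Ct); split; first by rewrite le_max lexx.
move=> m N d T P a d' T' P' X nrm b m0 model CtN.
move=> nrmZ nrm_bounds nrm_coord X_tilt.
have mR0 : 0 < m%:R :> R by rewrite ltr0n.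
have mN : (0 < m <= N)%N by rewrite m0 (leq_of_ratio _ CtN)// le_max lexx.
have N0 : (0 < N)%N by case/andP: mN; exact: leq_trans.
have {}CtN : Ct * m%:R <= N%:R.
  by rewrite (le_trans _ CtN)// ler_pM2r// le_max lexx orbT.
have nrm_ge w : l2norm w <= nrm w by have /andP[] := nrm_bounds w.
have nrm_le w : nrm w <= clip_level m N * l2norm w.
  by have /andP[] := nrm_bounds w.
have s0 := tilt_scale_gt0 C1; have c0 : 0 < c by case/andP: c01.
set D := 12 / (c * tilt_scale C).
have D0 : 0 < D by rewrite divr_gt0// mulr_gt0.
have [n [e [e01 bn De ne0 L_le]]] :=
  exists_discretization (tilt_scale C * b) m0 N0 D0.
have e0 : 0 < e by case/andP: e01.
pose Y := map_entries a (quant n e).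
have mY := measurable_map_entries a (@measurable_quant R n e e0).
pose Z := clip_ball N nrm; have unit_Z := unit_ball_clip_ball nrm_le.
have Z_bounded z : Z z -> l2norm z <= clip_level m N.
  exact: clip_ball_bounded.
pose bad (v : {ffun 'I_N -> {ffun 'I_m -> 'I_(n + n.+1)}}) :=
  ~~ `[< norming D (support_fun Z) (fun i => column (quant_val e) (v i)) >].
apply: (@with_prob_at_leastCU R d T P [set w | bad (Y w)]
  (entry_exceeds a (n%:R * e))).
- exact: (measurable_finite_event mY bad).
- exact: measurable_entry_exceeds.
- rewrite (prob_finite_event P mY bad) lee_fin.
  rewrite (law_map_entries model (measurable_quant e0)).
  apply: (norming_whp m N _ _ (quant_val e) Z) => //.
  + exact: disc_law_pmf.
  + exact: (disc_law_second_moment (model_sqr_moment model)).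
  + move=> z Zz j; apply: X_tilt => //.
    by rewrite normrM gtr0_norm// ler_pM2l// nrm_coord.
- by rewrite (le_trans (prob_entry_exceeds model ne0))// lee_fin.
move=> w /not_orP[/negP/negPn/asboolP good bounded] /=.
have -> : 24 / (c * tilt_scale C) = 2 * D by rewrite /D; ring.
apply: (l1_quotient_of_norming mN nrmZ nrm_ge nrm_le).
  by rewrite mulr_ge0// ltW.
apply: norming_perturbation De _ _ good => //; first exact: ltW.
  exact: (l2norm_le_support_fun unit_Z Z_bounded).
by move=> i; exact: quantized_column_close.
Qed.

End high_probability.

Section discrete_tilts.
Context {R : realType} {d : measure_display} {T : measurableType d}.
Variables (P : probability T R) (X : {RV P >-> R}).
Hypothesis X2 : ('E_P[fun w => (X w ^+ 2)%R] = 1)%E.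
Hypothesis X_sym : symmetric_rv P X.

Lemma disc_tiltable_bounded (p C c B b : R) :
  (p%:E <= P [set w | (1 / 2 < `|X w|)%R])%E ->
  1 <= C -> 0 <= c <= p / 4 -> 2 <= B ->
  b <= 1 -> disc_tiltable X C c B b.
Proof.
move=> pX C1 cp B2 b1 n e e01 bn z zb.
have b0 := le_trans (normr_ge0 z) zb.
by apply: (tiltable_disc_small X2 X_sym e01 _ pX) => //; lra.
Qed.

Lemma disc_tiltable_gauss (k sigma c B b : R) : 0 < k -> 0 < sigma ->
  (forall t, 0 < t ->
    ((gauss_tail k sigma t)%:E <= P [set w | (t < `|X w|)%R])%E) ->
  0 < c <= 1 -> c <= gauss_tail k sigma (1 / 2) / 4 -> 2 <= B ->
  expR (gauss_tilt_rate k sigma * b ^+ 2) <= B ->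
  disc_tiltable X (gauss_tilt_rate k sigma) c B b.
Proof.
move=> k0 s0 X_tail c01 c_le B2 eB n e e01 bn z zb.
have b0 := le_trans (normr_ge0 z) zb.
have rate1 := gauss_tilt_rate_ge1 sigma k0.
have [z1|/ltW z1] := leP `|z| 1.
  apply: (tiltable_disc_small X2 X_sym e01 _ (X_tail _ _)) => //; first by lra.
  by case/andP: c01 => /ltW ->.
apply: (tiltable_disc_large X2 X_sym k0 s0 X_tail) => //; first by lra.
apply: le_trans eB; rewrite ler_expR ler_wpM2l ?(le_trans ler01)//.
by rewrite -[leLHS]real_normK ?num_real// lerXn2r ?nnegrE.
Qed.

End discrete_tilts.

Section clipped_norms.
Context {R : realType} {m : nat}.
Implicit Types w : 'cV[R]_m.

Lemma norm_coord_le_linfnorm w j : `|w j ord0| <= linfnorm w.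
Proof. exact: (le_bigmax _ (fun j => `|w j ord0|)). Qed.

Lemma linfnorm_le w (b : R) : 0 <= b -> (forall j, `|w j ord0| <= b) ->
  linfnorm w <= b.
Proof. by move=> b0 wb; apply: bigmax_le. Qed.

Lemma linfnormZ (k : R) w : 0 < k -> linfnorm (k *: w) = k * linfnorm w.
Proof.
apply: homogeneous_of_le => {}k {}w k0.
have w0 : 0 <= linfnorm w by exact: bigmax_ge_id.
apply: linfnorm_le => [|j]; first by rewrite mulr_ge0// ltW.
by rewrite mxE normrM gtr0_norm// ler_pM2l// norm_coord_le_linfnorm.
Qed.

Lemma linfnorm_le_l2norm w : linfnorm w <= l2norm w.
Proof.
by apply: linfnorm_le => [|j]; [exact: l2norm_ge0|exact: norm_coord_le_l2norm].
Qed.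

Lemma clipped_normZ (al k : R) w : 0 < k ->
  clipped_norm al (k *: w) = k * clipped_norm al w.
Proof.
move=> k0; rewrite /clipped_norm l2normZ linfnormZ// gtr0_norm//.
by rewrite maxr_pMr ?ltW// mulrCA.
Qed.

Lemma clipped_norm_bounds (al : R) w : 1 <= al ->
  l2norm w <= clipped_norm al w <= al * l2norm w.
Proof.
move=> al1; rewrite /clipped_norm le_max lexx/= ge_max ler_peMl ?l2norm_ge0//=.
by rewrite ler_wpM2l ?(le_trans ler01)// linfnorm_le_l2norm.
Qed.

Lemma norm_coord_le_clipped (al : R) w j : 0 < al -> clipped_norm al w <= al ->
  `|w j ord0| <= 1.
Proof.
move=> al0; rewrite /clipped_norm ge_max => /andP[_ walpha].
rewrite (le_trans (norm_coord_le_linfnorm w j))//.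
by rewrite -(ler_pM2l al0) mulr1.
Qed.

End clipped_norms.

Section quotient_theorems.
Context {R : realType}.

Lemma clipped_l1_quotient_whp (p : R) : 0 < p <= 1 ->
  exists Ct D : R,
  forall (m N : nat) (d : measure_display) (T : measurableType d)
    (P : probability T R) (a : 'I_m -> 'I_N -> {RV P >-> R})
    (d' : measure_display) (T' : measurableType d')
    (P' : probability T' R) (X : {RV P' >-> R}),
  (0 < m)%N -> (0 < N)%N -> random_matrix_model a X ->
  (p%:E <= P' [set w | (1 / 2 < `|X w|)%R])%E ->
  Ct * m%:R <= N%:R ->
  quotient_property_whp a D (clipped_norm (clip_level m N) (n:=m)).
Proof.
move=> /andP[p0 p1]; have c01 : 0 < p / 4 <= 1 by lra.
have [Ct [Ct1 whp]] := l1_quotient_whp (lexx 1) c01.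
exists Ct, (24 / (p / 4 * tilt_scale 1)).
move=> m N d T P a d' T' P' X m0 N0 model tail CtN.
have al1 : 1 <= clip_level m N :> R.
  by apply: clip_level_ge1; rewrite m0 (leq_of_ratio Ct1 CtN).
apply: (whp m N d T P a d' T' P' X _ 1) => //.
- by move=> k w; exact: clipped_normZ.
- by move=> w; exact: clipped_norm_bounds.
- by move=> z z_le j; apply: norm_coord_le_clipped z_le; exact: lt_le_trans al1.
apply: (disc_tiltable_bounded (model_sqr_moment model)
  (model_symmetric model m0 N0) tail) => //.
- by rewrite lexx andbT; lra.
- exact: tilt_bound_ge2.
- by rewrite mulr1 tilt_scale_le1.
Qed.

Lemma l2_l1_quotient_whp (k sigma : R) : 0 < k -> 0 < sigma ->
  exists Ct D : R,
  forall (m N : nat) (d : measure_display) (T : measurableType d)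
    (P : probability T R) (a : 'I_m -> 'I_N -> {RV P >-> R})
    (d' : measure_display) (T' : measurableType d')
    (P' : probability T' R) (X : {RV P' >-> R}),
  (0 < m)%N -> (0 < N)%N -> random_matrix_model a X ->
  (forall t, 0 < t ->
    ((gauss_tail k sigma t)%:E <= P' [set w | (t < `|X w|)%R])%E) ->
  Ct * m%:R <= N%:R ->
  quotient_property_whp a D (@l2norm R m).
Proof.
move=> k0 s0; pose p := Num.min 1 (gauss_tail k sigma (1 / 2)).
have p0 : 0 < p by rewrite lt_min ltr01 mulr_gt0 ?expR_gt0.
have [p1 p_tail] : p <= 1 /\ p <= gauss_tail k sigma (1 / 2).
  by split; rewrite ge_min lexx ?orbT.
have c01 : 0 < p / 4 <= 1 by lra.
have rate1 := gauss_tilt_rate_ge1 sigma k0.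
have [Ct [Ct1 whp]] := l1_quotient_whp rate1 c01.
exists Ct, (24 / (p / 4 * tilt_scale (gauss_tilt_rate k sigma))).
move=> m N d T P a d' T' P' X m0 N0 model tail CtN.
have al1 : 1 <= clip_level m N :> R.
  by apply: clip_level_ge1; rewrite m0 (leq_of_ratio Ct1 CtN).
apply: (whp m N d T P a d' T' P' X _ (clip_level m N)) => //.
- by move=> c w c0; rewrite l2normZ gtr0_norm.
- by move=> w; rewrite lexx ler_peMl ?l2norm_ge0.
- by move=> z z_le j; exact: le_trans (norm_coord_le_l2norm z j) z_le.
apply: (disc_tiltable_gauss (model_sqr_moment model)
  (model_symmetric model m0 N0) k0 s0) => //.
- by lra.
- exact: tilt_bound_ge2.
- by rewrite exprMn ler_peMl ?expR_ge0// ler1n.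
Qed.

End quotient_theorems.

Theorem theorem2p3 (R : realType) :
  (* (a) weak moment assumption *)
  (exists c0 : R, 0 < c0 /\
   forall kappa1 gamma : R, 1 / 2 <= gamma ->
   exists Ct D : R,
   forall (m N : nat) (d : measure_display) (T : measurableType d)
     (P : probability T R) (a : 'I_m -> 'I_N -> {RV P >-> R})
     (d' : measure_display) (T' : measurableType d')
     (P' : probability T' R) (X : {RV P' >-> R}),
     (0 < m)%N -> (0 < N)%N ->
     random_matrix_model a X ->
     weak_moment P' X (Num.max 4 (ln (m%:R : R))) kappa1 gamma ->
     4 * expR (4 * gamma) * c0 ^+ 2 * kappa1 ^+ 2 * ln (m%:R : R) <= m%:R ->
     Num.max (Ct * m%:R) (ln (m%:R : R) `^ (2 * gamma - 1)) <= N%:R ->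
     with_prob_at_least P
       [set w | l1_quotient_property (scaled_matrix (fun j i => a j i : T -> R) w) D
                  (clipped_norm (Num.sqrt (ln (expR 1 * N%:R / m%:R))) (n:=m))]
       (1 - 2 * expR (- (2 * m%:R))))
  /\
  (* (b) super-Gaussian entries *)
  (forall sigma : R, 0 < sigma <= 1 ->
   exists Ct D : R,
   forall (m N : nat) (d : measure_display) (T : measurableType d)
     (P : probability T R) (a : 'I_m -> 'I_N -> {RV P >-> R})
     (d' : measure_display) (T' : measurableType d')
     (P' : probability T' R) (X : {RV P' >-> R}),
     (0 < m)%N -> (0 < N)%N ->
     random_matrix_model a X ->
     super_gaussian P' X sigma ->
     Ct * m%:R <= N%:R ->
     with_prob_at_least P
       [set w | l1_quotient_property (scaled_matrix (fun j i => a j i : T -> R) w) D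
                  (@l2norm R m)]
       (1 - 2 * expR (- (2 * m%:R)))).
Proof.
split.
  exists 1; split=> // kappa1 gamma _; pose L := (kappa1 * 4 `^ gamma) ^+ 4.
  have L0 : 0 <= L by rewrite exprn_even_ge0.
  have p01 : 0 < (2 * (4 * L + 1))^-1 <= 1.
    by rewrite invr_gt0 invf_le1; lra.
  have [Ct [D quotient]] := clipped_l1_quotient_whp p01.
  exists Ct, D => m N d T P a d' T' P' X m0 N0 model moment _.
  rewrite ge_max => /andP[CtN _]; apply: (quotient _ _ _ _ _ _ _ _ _ X) => //.
  apply: (fourth_moment_anticoncentration (model_sqr_moment model) L0).
  by apply: integral_pow4_le; apply: moment; rewrite lexx le_max lexx.
move=> sigma /andP[s0 _].
have peak0 : 0 < normal_peak 1 :> R by rewrite normal_peak_gt0// oner_eq0.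
have [Ct [D quotient]] := l2_l1_quotient_whp peak0 s0.
exists Ct, D => m N d T P a d' T' P' X m0 N0 model super CtN.
apply: (quotient _ _ _ _ _ _ _ _ _ X) => // t t0.
exact: le_trans (normal_tail_ge s0 t0) (super t t0).
Qed.
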